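(* Let $T$ be a triangulation of a convex polygon, let $n$ be the number of arcs in $T$, and let $t$ be the number of interior triangles of $T$ (triangles of $T$ all three of whose sides are arcs of $T$; equivalently, the number of oriented 3-cycles in $Q_T$). Then every maximal green sequence for $Q_T$ has length at least $n + t$.
   Context: For a convex polygon $S$, an arc is a diagonal of $S$, and a triangulation $T$ is a maximal collection of arcs which pairwise do not intersect in the interior of $S$. The quiver $Q_T$ has one vertex for each arc of $T$, and for any two arcs $i, j$ that are sides of a common triangle $\Delta$ of $T$, an arrow $i \to j$ if $j$ follows $i$ in $\Delta$ with respect to the counterclockwise orientation of $S$. Mutation $\mu_k$ of a quiver at $k$: for every path $h \to k \to l$ add an arrow $h \to l$; reverse all arrows at $k$; remove a maximal collection of oriented 2-cycles. The framed quiver $\hat{Q}$ adds a frozen vertex $k'$ and an arrow $k \to k'$ for each vertex $k$; frozen vertices are never mutated. A non-frozen vertex is green if no arrow goes from a frozen vertex into it, and red if no arrow goes from it into a frozen vertex. A maximal green sequence for $Q$ is a finite sequence of mutations of $\hat{Q}$ at non-frozen vertices, each at a vertex green at that moment, after which all non-frozen vertices are red; its length is the number of mutations. *)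

(* Defs.v *)
From mathcomp Require Import all_boot all_order all_algebra.

Set Implicit Arguments.
Unset Strict Implicit.
Unset Printing Implicit Defensive.

Import Order.TTheory GRing.Theory Num.Theory.
Local Open Scope ring_scope.

(* Twice the signed area of the triangle a b c: positive iff a, b, c are in
   counterclockwise order. *)
Definition orient (R : realFieldType) (a b c : 'rV[R]_2) : R :=
  (b 0 0 - a 0 0) * (c 0 1 - a 0 1) - (b 0 1 - a 0 1) * (c 0 0 - a 0 0).

(* The points p 0, ..., p (N - 1) are the corners of a strictly convex polygon,
   listed counterclockwise. *)
Definition convex_polygon (R : realFieldType) (N : nat)
    (p : 'I_N -> 'rV[R]_2) : Prop :=
  forall i j k : 'I_N, (i < j)%N -> (j < k)%N -> 0 < orient (p i) (p j) (p k).

Definition in_interior (R : realFieldType) (N : nat)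
    (p : 'I_N -> 'rV[R]_2) (x : 'rV[R]_2) : Prop :=
  forall i : 'I_N, 0 < orient (p i) (p (ordS i)) x.

(* Sides and diagonals are represented by their sets of two endpoints. *)
Definition is_side (N : nat) (e : {set 'I_N}) : bool :=
  [exists i : 'I_N, e == [set i; ordS i]].

Definition is_arc (N : nat) (e : {set 'I_N}) : bool :=
  (#|e| == 2)%N && ~~ is_side e.

Definition on_segment (R : realFieldType) (N : nat)
    (p : 'I_N -> 'rV[R]_2) (e : {set 'I_N}) (x : 'rV[R]_2) : Prop :=
  exists (a b : 'I_N) (r : R),
    [/\ e = [set a; b], 0 <= r <= 1 & x = (1 - r) *: p a + r *: p b].

Definition intersect_in_interior (R : realFieldType) (N : nat)
    (p : 'I_N -> 'rV[R]_2) (d e : {set 'I_N}) : Prop :=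
  exists x : 'rV[R]_2, [/\ in_interior p x, on_segment p d x & on_segment p e x].

Definition noncrossing_arcs (R : realFieldType) (N : nat)
    (p : 'I_N -> 'rV[R]_2) (T : {set {set 'I_N}}) : Prop :=
  (forall d, d \in T -> is_arc d) /\
  (forall d e, d \in T -> e \in T -> d != e -> ~ intersect_in_interior p d e).

Definition triangulation (R : realFieldType) (N : nat)
    (p : 'I_N -> 'rV[R]_2) (T : {set {set 'I_N}}) : Prop :=
  noncrossing_arcs p T /\
  (forall T' : {set {set 'I_N}},
     noncrossing_arcs p T' -> T \subset T' -> T' = T).

(* A triangle of T is represented by its set of three corners. *)
Definition is_triangle (N : nat) (T : {set {set 'I_N}}) (D : {set 'I_N}) : bool :=
  (#|D| == 3)%N &&
  [forall e : {set 'I_N},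
     (e \subset D) && (#|e| == 2)%N ==> is_side e || (e \in T)].

Definition is_interior_triangle (N : nat) (T : {set {set 'I_N}})
    (D : {set 'I_N}) : bool :=
  (#|D| == 3)%N &&
  [forall e : {set 'I_N}, (e \subset D) && (#|e| == 2)%N ==> (e \in T)].

Definition num_interior_triangles (N : nat) (T : {set {set 'I_N}}) : nat :=
  #|[set D : {set 'I_N} | is_interior_triangle T D]|.

(* Going counterclockwise around the triangle D, the side i is followed by j. *)
Definition follows (R : realFieldType) (N : nat) (p : 'I_N -> 'rV[R]_2)
    (D i j : {set 'I_N}) : bool :=
  [exists a : 'I_N, exists b : 'I_N, exists c : 'I_N,
    [&& D == [set a; b; c], 0 < orient (p a) (p b) (p c),
        i == [set a; b] & j == [set b; c]]].

(* Q x y is the number of arrows x -> y. *)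
Definition quiver (V : finType) : Type := V -> V -> nat.

Definition quiver_of_triangulation (R : realFieldType) (N : nat)
    (p : 'I_N -> 'rV[R]_2) (T : {set {set 'I_N}}) :
    quiver {d : {set 'I_N} | d \in T} :=
  fun i j =>
    #|[set D : {set 'I_N} | is_triangle T D && follows p D (val i) (val j)]|.

Arguments quiver_of_triangulation {R N} p T _ _.

Definition add_paths (V : finType) (k : V) (Q : quiver V) : quiver V :=
  fun h l => (Q h l + Q h k * Q k l)%N.

Definition reverse_at (V : finType) (k : V) (Q : quiver V) : quiver V :=
  fun x y => if (x == k) || (y == k) then Q y x else Q x y.

(* The subtraction is truncated. *)
Definition cancel_2cycles (V : finType) (Q : quiver V) : quiver V :=
  fun x y => (Q x y - Q y x)%N.

Definition mutation (V : finType) (k : V) (Q : quiver V) : quiver V :=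
  cancel_2cycles (reverse_at k (add_paths k Q)).

(* inl k is the mutable vertex k, inr k is the frozen vertex k'. *)
Definition framed (V : finType) (Q : quiver V) : quiver (V + V)%type :=
  fun x y =>
    match x, y with
    | inl i, inl j => Q i j
    | inl i, inr j => (i == j : nat)
    | inr _, _ => 0%N
    end.

Definition green (V : finType) (Q : quiver (V + V)%type) (k : V) : bool :=
  [forall f : V, Q (inr f) (inl k) == 0%N].

Definition red (V : finType) (Q : quiver (V + V)%type) (k : V) : bool :=
  [forall f : V, Q (inl k) (inr f) == 0%N].

Fixpoint green_to_red (V : finType) (Q : quiver (V + V)%type) (s : seq V) : bool :=
  match s with
  | [::] => [forall k : V, red Q k]
  | k :: s' => green Q k && green_to_red (mutation (inl k) Q) s'
  end.

Definition maximal_green_sequence (V : finType) (Q : quiver V) (s : seq V) : bool :=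
  green_to_red (framed Q) s.

(* Main.v *)
(* Mutating the framed quiver at a green vertex flips the corresponding arc, and
   the c-vectors are the tropical cross-ratios (shear coordinates) of the
   quadrilaterals of the current triangulation with respect to the initial arcs.
   Dually, the shear coordinates g_h of the current arcs at the initial ones (the
   g-vectors) satisfy \sum_h g_h (x) c_h = Id.  Since the current arcs do not
   cross, for each initial arc i the numbers (g_h)_i never have both signs; they
   are nonnegative at the start and not at the end, and at the step tau_i where
   their sign changes the mutated c-vector is e_i.  This gives n steps.
   For an arrow i -> j with tau_j < tau_i, between the two steps
   (g_h)_i >= 0 >= (g_h)_j, and in this quadrant the sign of (g_h)_i + (g_h)_j is
   again coherent and changes, at a step whose c-vector is e_i + e_j.  Around an
   oriented 3-cycle the tau cannot increase along all three arrows, so every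
   interior triangle contributes one more step; two triangles share at most one
   arc, so these steps are distinct. *)
Require Import Defs.
From mathcomp Require Import all_boot all_order all_algebra.
From mathcomp Require Import zify ring lra.

Set Implicit Arguments.
Unset Strict Implicit.
Unset Printing Implicit Defensive.

(** * Reduction of statements about the order of a few numbers to a finite test *)

Definition order_table (v : seq nat) : seq (seq bool) :=
  [seq [seq x < y | y <- v] | x <- v].

Definition lt_nat : rel nat := fun x y => x < y.

Definition table_lt (t : seq (seq bool)) : rel nat :=
  fun i j => nth false (nth [::] t i) j.

Fixpoint words (n k : nat) : seq (seq nat) :=
  if k is k'.+1 then [seq x :: w | x <- iota 0 n, w <- words n k'] else [:: [::]].

Lemma mem_words n (w : seq nat) : all (fun x => x < n) w -> w \in words n (size w).
Proof.
elim: w => //= x w IH /andP[hx /IH hw].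
by apply/allpairsP; exists (x, w); rewrite /= mem_iota.
Qed.

(* A property of the relative order of n numbers only needs to be tested on
   numbers below n, since replacing each number by its rank preserves the
   order. *)
Lemma order_check n (F : seq (seq bool) -> bool) :
  all (fun w => F (order_table w)) (words n n) ->
  forall v : seq nat, size v = n -> F (order_table v).
Proof.
move=> /allP hF v hv.
pose rk x := count (fun y => y < x) v.
have le_rk x y : x <= y -> rk x <= rk y.
  by move=> lexy; apply: sub_count => z /= zx; apply: leq_trans lexy.
have lt_rk x y : x \in v -> x < y -> rk x < rk y.
  move=> xv ltxy.
  suff : rk x + count_mem x v <= rk y.
    by apply: leq_trans; rewrite -addn1 leq_add2l -has_count has_pred1.
  rewrite -count_predUI (@eq_count _ (predI _ _) pred0) ?count_pred0 ?addn0.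
    by apply: sub_count => z /= /orP[zx|/eqP-> //]; apply: ltn_trans ltxy.
  by move=> z /=; case: eqP => [->|]; rewrite ?ltnn ?andbF.
have rk_lt x : x \in v -> rk x < n.
  move=> xv; rewrite -hv -(count_predC (fun y => y < x) v) -addn1 leq_add2l.
  by rewrite -has_count; apply/hasP; exists x => //=; rewrite ltnn.
have -> : order_table v = order_table (map rk v).
  rewrite /order_table -map_comp; apply/eq_in_map => x xv /=.
  rewrite -map_comp; apply/eq_in_map => y yv /=.
  case: (ltnP x y) => [/(lt_rk _ _ xv)-> // | /le_rk]; by rewrite leqNgt => /negbTE.
apply: hF; rewrite -[X in words _ X]hv -(size_map rk v).
by apply: mem_words; rewrite all_map; apply/allP => x /rk_lt.
Qed.

(** * Cyclic order *)

(* The order is a parameter so that order_check can replace the numbers by their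
   ranks. *)
Definition cyc_for (lt : rel nat) (a b c : nat) : bool :=
  [|| lt a b && lt b c, lt b c && lt c a | lt c a && lt a b].
Definition cross_for (lt : rel nat) (a b x y : nat) : bool :=
  (cyc_for lt a x b && cyc_for lt b y a) || (cyc_for lt a y b && cyc_for lt b x a).
(** Equality is expressed through [lt] so that it, too, depends only on the order table. *)
Definition eq_for (lt : rel nat) (x y : nat) : bool := ~~ lt x y && ~~ lt y x.
(* x lies in the half-open cyclic interval from u (included) to v (excluded). *)
Definition inn_for (lt : rel nat) (u v x : nat) : bool :=
  eq_for lt x u || cyc_for lt u x v.
(* The chord uv, with both ends moved slightly clockwise, separates x and y. *)
Definition sep_for (lt : rel nat) (u v x y : nat) : nat :=
  inn_for lt u v x (+) inn_for lt u v y.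

Notation cyc := (cyc_for lt_nat).
Notation cross := (cross_for lt_nat).
Notation inn := (inn_for lt_nat).
Notation sep := (sep_for lt_nat).

Lemma eq_forP x y : reflect (x = y) (eq_for lt_nat x y).
Proof. by apply: (iffP idP); rewrite /eq_for -!leqNgt andbC -eqn_leq => /eqP. Qed.

(** Hypotheses are folded into one boolean implication; abstracted over [lt_nat] and the numbers, it
    becomes a property of the order table, tested by computation on all words. *)
Ltac to_formula :=
  intros; repeat match goal with H : is_true _ |- _ => move: H; apply/implyP end.
Ltac order4 a b c d :=
  match goal with |- is_true ?B =>
    let B' := eval pattern lt_nat, a, b, c, d in B in
    match B' with ?F lt_nat a b c d =>
      exact: (@order_check 4 (fun t => F (table_lt t) 0 1 2 3)
        ltac:(by vm_compute) [:: a; b; c; d] erefl) end end.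
Ltac order5 a b c d e :=
  match goal with |- is_true ?B =>
    let B' := eval pattern lt_nat, a, b, c, d, e in B in
    match B' with ?F lt_nat a b c d e =>
      exact: (@order_check 5 (fun t => F (table_lt t) 0 1 2 3 4)
        ltac:(by vm_compute) [:: a; b; c; d; e] erefl) end end.
Ltac order6 a b c d u v :=
  match goal with |- is_true ?B =>
    let B' := eval pattern lt_nat, a, b, c, d, u, v in B in
    match B' with ?F lt_nat a b c d u v =>
      exact: (@order_check 6 (fun t => F (table_lt t) 0 1 2 3 4 5)
        ltac:(by vm_compute) [:: a; b; c; d; u; v] erefl) end end.

Lemma neq_for x y : x != y = ~~ eq_for lt_nat x y.
Proof. by congr (~~ _); apply/eqP/eq_forP. Qed.

(** If [z] comes before [z'] on the way from [y] to [x], then [xz] crosses [yz']; in the other order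
    [xz'] crosses [yz]. *)
Lemma cyc_apex_unique x y z z' : cyc x y z -> cyc x y z' ->
  ~~ cross x z y z' -> ~~ cross x z' y z -> z = z'.
Proof.
move=> h1 h2 h3 h4; apply/eq_forP; to_formula.
order4 x y z z'.
Qed.

Lemma diagonals_cross a b c d : cyc a b c -> cyc c d a -> cross b d a c.
Proof. to_formula. order4 a b c d. Qed.

Lemma cross_diagonal a b c d x y : cyc a b c -> cyc c d a -> cross b d x y ->
  ~~ cross a b x y -> ~~ cross b c x y -> ~~ cross c d x y -> ~~ cross d a x y ->
  (x = a /\ y = c) \/ (x = c /\ y = a).
Proof.
move=> h1 h2 h3 h4 h5 h6 h7.
suff /orP[/andP[/eq_forP-> /eq_forP->]|/andP[/eq_forP-> /eq_forP->]] :
  eq_for lt_nat x a && eq_for lt_nat y c || eq_for lt_nat x c && eq_for lt_nat y a; auto.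
to_formula.
order6 a b c d x y.
Qed.

(** This is the tropical Ptolemy relation: the crossing numbers of the two diagonals add up to the
    larger of the two sums over opposite sides. The inequality tells which sum is the larger. *)
Lemma tropical_exchange a b c d u v :
  cyc a b c -> cyc c d a -> u != v ->
  sep u v a b + sep u v c d <= sep u v b c + sep u v d a ->
  sep u v a c + sep u v b d = sep u v b c + sep u v d a.
Proof.
rewrite neq_for => h1 h2 h3 h4; apply/eqP.
to_formula.
order6 a b c d u v.
Qed.

(** Start of the induction on c-vectors: the tropical cross-ratio of an initial quadrilateral is 2
    at its own diagonal and 0 at the other arcs. *)
Lemma sep_initial a b c d u v : cyc a b c -> cyc c d a -> u != v ->
  ~~ cross a b u v -> ~~ cross b c u v -> ~~ cross c d u v -> ~~ cross d a u v ->
  ~~ cross a c u v ->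
  sep u v b c + sep u v d a = sep u v a b + sep u v c d +
    ((eq_for lt_nat a u && eq_for lt_nat c v) || (eq_for lt_nat a v && eq_for lt_nat c u)).*2.
Proof.
rewrite neq_for => h1 h2 h3 h4 h5 h6 h7 h8; apply/eqP.
to_formula.
order6 a b c d u v.
Qed.

(** For a chord crossing neither sides nor diagonals the two sums over opposite sides agree; this
    serves for the sides of the polygon. *)
Lemma noncrossing_exchange a b c d u v : cyc a b c -> cyc c d a -> u != v ->
  ~~ cross a b u v -> ~~ cross b c u v -> ~~ cross c d u v -> ~~ cross d a u v ->
  ~~ cross a c u v -> ~~ cross b d u v ->
  sep u v a c + sep u v b d = sep u v b c + sep u v d a.
Proof. by rewrite neq_for => *; apply/eqP; to_formula; order6 a b c d u v. Qed.

Lemma cross_sym a b x y : cross a b x y = cross x y a b.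
Proof. by apply/eqP; order4 a b x y. Qed.

Lemma cross_flipl a b x y : cross a b x y = cross b a x y.
Proof. by apply/eqP; order4 a b x y. Qed.

Lemma cross_flipr a b x y : cross a b x y = cross a b y x.
Proof. by apply/eqP; order4 a b x y. Qed.

Lemma sep_sym u v x y : u != v -> sep u v x y = sep v u x y.
Proof. by rewrite neq_for => *; apply/eqP; to_formula; order4 u v x y. Qed.

Lemma inn_cyc p q r x y z : cyc p q r -> inn p q x -> inn q r y -> inn r p z ->
  cyc x y z.
Proof. to_formula. order6 p q r x y z. Qed.

Lemma inn_join p q r x : cyc p q r -> inn p r x = inn p q x || inn q r x.
Proof. by move=> *; apply/eqP; to_formula; order4 p q r x. Qed.

(* For p, q, r, s in cyclic order: the chord xy, with both ends moved slightly
   counterclockwise, joins the sides pq and rs. *)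
Definition joins_for (lt : rel nat) (p q r s x y : nat) : bool :=
  (inn_for lt p q x && inn_for lt r s y) || (inn_for lt p q y && inn_for lt r s x).
Notation joins := (joins_for lt_nat).

(** Twice a shear coordinate is thus a signed sum of crossing numbers with the four sides, so linear
    relations between crossing numbers pass to shear coordinates. *)
Lemma sep_joins p q r s x y : cyc p q r -> cyc r s p ->
  sep p q x y + sep r s x y + (joins q r s p x y).*2 =
  sep q r x y + sep s p x y + (joins p q r s x y).*2.
Proof. by move=> *; apply/eqP; to_formula; order6 p q r s x y. Qed.

Lemma joins_excl p q r s x y : cyc p q r -> cyc r s p ->
  joins p q r s x y -> ~~ joins q r s p x y.
Proof. by to_formula; order6 p q r s x y. Qed.

Lemma joins_noncrossing p q r s x y : cyc p q r -> cyc r s p -> x != y ->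
  ~~ cross p q x y -> ~~ cross q r x y -> ~~ cross r s x y -> ~~ cross s p x y ->
  ~~ cross p r x y ->
  ~~ joins q r s p x y && (joins p q r s x y ==
    (eq_for lt_nat p x && eq_for lt_nat r y || eq_for lt_nat p y && eq_for lt_nat r x)).
Proof. by rewrite neq_for => *; to_formula; order6 p q r s x y. Qed.

(** Source of sign coherence: of two chords joining different pairs of opposite sides, each
    separates the ends of the other. *)
Lemma joins_cross p q r s x y z w : cyc p q r -> cyc r s p ->
  joins p q r s x y -> joins q r s p z w -> cross x y z w.
Proof.
move=> h1 h2.
have aux x' y' z' w' : inn p q x' -> inn r s y' -> inn q r z' -> inn s p w' ->
    cross x' y' z' w'.
  move=> hx hy hz hw; apply/orP; left; apply/andP; split.
    apply: (inn_cyc h1 hx hz); rewrite (inn_join _ h2) hy //.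
  apply: (inn_cyc h2 hy hw); rewrite (inn_join _ h1) hx //.
move=> /orP[] /andP[hx hy] /orP[] /andP[hz hw].
- exact: aux.
- by rewrite cross_flipr; apply: aux.
- by rewrite cross_flipl; apply: aux.
- by rewrite cross_flipl cross_flipr; apply: aux.
Qed.

(** A chord that enters the triangle through [bc] and crosses no other side can only end at the
    corner [a]. *)
Lemma cross_fan a b c x y : cyc a b c -> cross b c x y ->
  ~~ cross a c x y -> ~~ cross a b x y ->
  eq_for lt_nat y a && cyc_for lt_nat b x c || eq_for lt_nat x a && cyc_for lt_nat b y c.
Proof. by to_formula; order5 a b c x y. Qed.

Lemma eq_set2 N (a b x y : 'I_N) : ([set a; b] == [set x; y]) =
  (a == x :> nat) && (b == y :> nat) || (a == y :> nat) && (b == x :> nat).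
Proof.
rewrite !val_eqE; apply/eqP/idP => [e | /orP[] /andP[/eqP-> /eqP->] //]; last exact: setUC.
have : a \in [set x; y] by rewrite -e set21.
have : b \in [set x; y] by rewrite -e set22.
have : x \in [set a; b] by rewrite e set21.
have : y \in [set a; b] by rewrite e set22.
rewrite !inE !(eq_sym x) !(eq_sym y).
by case: (a == x); case: (a == y); case: (b == x); case: (b == y).
Qed.

Lemma cyc_rot a b c : cyc a b c = cyc b c a.
Proof. by rewrite /cyc_for; case: lt_nat; case: lt_nat; case: lt_nat. Qed.

Lemma cyc_uniq a b c : cyc a b c -> [&& a != b, b != c & c != a].
Proof. by rewrite /cyc_for /lt_nat; lia. Qed.

(** * Flips of triangulations *)

Section Polygon.
Variables (N : nat) (V : finType).
Implicit Types (x y z w : 'I_N) (f : V -> {set 'I_N}).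

Lemma side_noncrossing x y z w : is_side [set x; y] -> ~~ cross x y z w.
Proof.
have aux (i j z' w' : nat) : i < N -> z' < N -> w' < N -> j = i.+1 %% N ->
    ~~ cross i j z' w'.
  (* The last side joins [N - 1] to [0], so the successor modulo [N] needs two cases. *)
  move=> hi hz hw; have [/eqP ? | iN] := boolP (i.+1 == N); last first.
    by rewrite modn_small /cross_for /cyc_for /lt_nat; lia.
  by subst N; rewrite modnn /cross_for /cyc_for /lt_nat; lia.
move=> /existsP[i]; rewrite eq_set2 => /orP[] /andP[/eqP/val_inj-> /eqP/val_inj->]; last rewrite cross_flipl;
  exact: aux.
Qed.

(** A triangulation is given by a labelling [f] of its arcs by the vertices of the quiver; a flipped
    arc keeps its label. *)
Definition edge f x y := is_side [set x; y] || [exists h, f h == [set x; y]].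
Definition tri f x y z := [&& cyc x y z, edge f x y, edge f y z & edge f z x].
Definition quad f h x y z w := [&& f h == [set x; z], tri f x y z & tri f z w x].

Definition noncrossing f := forall h l x y z w,
  f h = [set x; y] -> f l = [set z; w] -> ~~ cross x y z w.

Lemma edgeC f x y : edge f x y = edge f y x.
Proof. by rewrite /edge setUC. Qed.

Lemma edge_noncrossing f x y z w : noncrossing f -> edge f x y -> edge f z w ->
  ~~ cross x y z w.
Proof.
move=> nf /orP[/side_noncrossing-> // |/existsP[h /eqP hh]].
move=> /orP[/side_noncrossing|/existsP[l /eqP hl]]; first by rewrite cross_sym.
exact: nf hh hl.
Qed.

Lemma tri_rot f x y z : tri f x y z -> tri f y z x.
Proof. by rewrite /tri cyc_rot => /and4P[-> -> -> ->]. Qed.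

Lemma tri_apex f x y z z' : noncrossing f -> tri f x y z -> tri f x y z' -> z = z'.
Proof.
move=> nf /and4P[h1 _ h2 h3] /and4P[h4 _ h5 h6]; apply/val_inj.
by apply: (cyc_apex_unique h1 h4); apply: (edge_noncrossing nf) => //; rewrite edgeC.
Qed.

Lemma quad_rot f h x y z w : quad f h x y z w -> quad f h z w x y.
Proof. by rewrite /quad setUC => /and3P[-> -> ->]. Qed.

Definition flip f k (e : {set 'I_N}) : V -> {set 'I_N} :=
  fun h => if h == k then e else f h.

Section Flip.
Variables (f : V -> {set 'I_N}) (k : V) (a b c d : 'I_N).
Hypotheses (f_inj : injective f) (f_nc : noncrossing f) (kq : quad f k a b c d).
Let g := flip f k [set b; d].

Let fk : f k = [set a; c]. Proof. by case/and3P: kq => /eqP. Qed.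
Let tabc : tri f a b c. Proof. by case/and3P: kq. Qed.
Let tcda : tri f c d a. Proof. by case/and3P: kq. Qed.
Let cabc : cyc a b c. Proof. by case/and4P: tabc. Qed.
Let ccda : cyc c d a. Proof. by case/and4P: tcda. Qed.

Lemma quad_points : [&& a != b :> nat, b != c :> nat, c != a :> nat,
  c != d :> nat, d != a :> nat & b != d :> nat].
Proof. by move: cabc ccda; rewrite /cyc_for /lt_nat; lia. Qed.

Lemma quad_cyc : cyc a b d /\ cyc b c d.
Proof. by move: cabc ccda; rewrite /cyc_for /lt_nat; lia. Qed.

(** An edge crosses none of the four sides of the quadrilateral, and a chord that crosses [bd] but
    none of them is the other diagonal. *)
Lemma cross_bd x y : edge f x y -> cross b d x y -> [set x; y] = [set a; c].
Proof.
move=> exy hx; case/and4P: tabc => _ e1 e2 _; case/and4P: tcda => _ e3 e4 _.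
have nc z w : edge f z w -> ~~ cross z w x y by move=> e; apply: edge_noncrossing e exy.
have := cross_diagonal cabc ccda hx (nc _ _ e1) (nc _ _ e2) (nc _ _ e3) (nc _ _ e4).
by case=> -[/val_inj-> /val_inj->] //; rewrite setUC.
Qed.

Lemma edge_of_f h x y : f h = [set x; y] -> edge f x y.
Proof. by move=> e; apply/orP; right; apply/existsP; exists h; rewrite e. Qed.

Lemma not_edge_bd : ~~ edge f b d.
Proof.
apply/negP => e; have := edge_noncrossing f_nc e (edge_of_f fk).
by rewrite diagonals_cross.
Qed.

Lemma edge_ac_bd x y : edge f x y -> [set x; y] != [set b; d].
Proof. by apply: contraTneq; rewrite /edge => ->; apply: not_edge_bd. Qed.

Lemma flip_eq_k x y : (g k == [set x; y]) = ([set b; d] == [set x; y]).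
Proof. by rewrite /g /flip eqxx. Qed.

Lemma flip_neq_k h : h != k -> g h = f h.
Proof. by rewrite /g /flip => /negbTE->. Qed.

Lemma flip_inj : injective g.
Proof.
have fb h : f h != [set b; d].
  by apply: contraNneq not_edge_bd; apply: edge_of_f.
move=> h l; rewrite /g /flip; case: eqP => [->|_]; case: eqP => [->|_] //.
- by move=> e; have := fb l; rewrite -e eqxx.
- by move=> e; have := fb h; rewrite e eqxx.
- exact: f_inj.
Qed.

Lemma flip_noncrossing : noncrossing g.
Proof.
have bdn h x y : h != k -> f h = [set x; y] -> ~~ cross b d x y.
  move=> hk e; apply: contra hk => /(cross_bd (edge_of_f e)) e'.
  by apply/eqP/f_inj; rewrite fk e.
have aux x y z w : [set b; d] = [set x; y] -> cross x y z w = cross b d z w.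
  move=> /eqP; rewrite eq_set2 => /orP[] /andP[/eqP/val_inj-> /eqP/val_inj->] //; exact: cross_flipl.
move=> h l x y z w; rewrite /g /flip.
case: eqP => [_|/eqP hk]; case: eqP => [_|/eqP lk].
- move=> /aux-> /aux e; rewrite cross_sym e.
  by rewrite /cross_for /cyc_for /lt_nat; lia.
- by move=> /aux-> /bdn->.
- by move=> /bdn h1 /aux; rewrite cross_sym => ->; apply: h1.
- exact: f_nc.
Qed.

Lemma flip_edge_cases x y : edge g x y -> [set x; y] = [set b; d] \/ edge f x y.
Proof.
move=> /orP[e|/existsP[h]]; first by right; rewrite /edge e.
rewrite /g /flip; case: (h == k) => /eqP e; first by left.
by right; apply: edge_of_f e.
Qed.

Lemma edge_flip x y : edge f x y -> [set x; y] != [set a; c] -> edge g x y.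
Proof.
move=> /orP[e|/existsP[h /eqP e]] n; first by rewrite /edge e.
apply/orP; right; apply/existsP; exists h; rewrite flip_neq_k ?e //.
by apply: contraNneq n => ?; subst h; rewrite -e fk.
Qed.

Lemma edge_bd : edge g b d.
Proof. by apply/orP; right; apply/existsP; exists k; rewrite flip_eq_k. Qed.

Lemma flip_edge_ac x y : edge g x y -> [set x; y] != [set a; c].
Proof.
apply: contraTneq => exy; rewrite /edge exy; apply/negP => e.
have := edge_noncrossing flip_noncrossing edge_bd e.
by rewrite diagonals_cross.
Qed.

Lemma tri_flip x y z : tri f x y z -> [set x; y] != [set a; c] ->
  [set y; z] != [set a; c] -> [set z; x] != [set a; c] -> tri g x y z.
Proof. by move=> /and4P[h1 h2 h3 h4] *; rewrite /tri h1 !edge_flip. Qed.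

Lemma set_b_neq x : [set b; x] != [set a; c].
Proof.
case/and5P: quad_points => n1 n2 _ _ _.
by rewrite eq_set2 (eq_sym (b : nat)) (negbTE n1) (negbTE n2).
Qed.

Lemma set_d_neq x : [set d; x] != [set a; c].
Proof.
case/and5P: quad_points => _ _ _ n4 /andP[n5 _].
by rewrite eq_set2 (eq_sym (d : nat) c) (negbTE n4) (negbTE n5).
Qed.

Lemma flip_tris : tri g a b d /\ tri g b c d.
Proof.
case/and4P: tabc => _ e1 e2 _; case/and4P: tcda => _ e3 e4 _.
have [h1 h2] := quad_cyc; have e5 := edge_bd.
rewrite /tri h1 h2 /= e5 (edgeC g d b) e5 andbT /=.
by rewrite !edge_flip ?set_b_neq ?set_d_neq // setUC ?set_b_neq ?set_d_neq.
Qed.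

(** The new triangles already occupy both sides of [bd], and the apex on each side is unique. *)
Lemma tri_flip_bd x y z : tri g x y z -> [set x; y] = [set b; d] ->
  (x, y, z) = (b, d, a) \/ (x, y, z) = (d, b, c).
Proof.
case: flip_tris => /tri_rot t1 /tri_rot/tri_rot t2 t /eqP.
rewrite eq_set2 => /orP[] /andP[/eqP/val_inj ? /eqP/val_inj ?]; subst x y.
  by left; rewrite (tri_apex flip_noncrossing t t1).
by right; rewrite (tri_apex flip_noncrossing t t2).
Qed.

Definition new_tris := [:: (a, b, d); (b, d, a); (d, a, b);
  (b, c, d); (c, d, b); (d, b, c)].

Lemma tri_flip_cases x y z : tri g x y z -> tri f x y z \/ (x, y, z) \in new_tris.
Proof.
move=> t; case/and4P: (t) => cx e1 e2 e3.
have [xy|e1'] := flip_edge_cases e1.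
  by right; case: (tri_flip_bd t xy) => ->; rewrite !inE eqxx ?orbT.
have [yz|e2'] := flip_edge_cases e2.
  right; case: (tri_flip_bd (tri_rot t) yz) => -[-> -> ->];
    by rewrite !inE eqxx ?orbT.
have [zx|e3'] := flip_edge_cases e3.
  right; case: (tri_flip_bd (tri_rot (tri_rot t)) zx) => -[-> -> ->];
    by rewrite !inE eqxx ?orbT.
by left; rewrite /tri cx e1' e2'.
Qed.

Lemma quad_flip_self : quad g k b c d a.
Proof.
case: flip_tris => t1 t2; rewrite /quad flip_eq_k eqxx t2 /=.
exact: tri_rot (tri_rot t1).
Qed.

Lemma quad_flip_k x y z w : quad g k x y z w ->
  (x, y, z, w) = (b, c, d, a) \/ (x, y, z, w) = (d, a, b, c).
Proof.
move=> /and3P[]; rewrite flip_eq_k => /eqP e t1 t2.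
have := quad_points.
case: (tri_flip_bd (tri_rot (tri_rot t1)) _); first by rewrite e setUC.
- move=> [zb xd ya]; case: (tri_flip_bd (tri_rot (tri_rot t2)) (esym e)) => -[xb zd wa].
    by rewrite -xb xd eqxx /= !andbF.
  by move=> _; right; rewrite zb xd ya wa.
- move=> [zd xb yc]; case: (tri_flip_bd (tri_rot (tri_rot t2)) (esym e)) => -[xb' zd' wa].
    by move=> _; left; rewrite zd xb yc wa.
  by rewrite -xb xb' eqxx /= !andbF.
Qed.



(* A quadrilateral of the flipped triangulation around da (resp. ab) consists of
   the new triangle abd and an old triangle. *)
Definition half_new (a b c d x y z w : 'I_N) :=
  ((x, y, z) == (a, b, d)) && tri f d w a || ((x, y, z) == (b, d, a)) && tri f a w b.

Lemma quad_flip_neq h x y z w : h != k -> quad g h x y z w ->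
  [|| quad f h x y z w, half_new a b c d x y z w, half_new c d a b x y z w,
      half_new a b c d z w x y | half_new c d a b z w x y].
Proof.
move=> hk /and3P[/eqP gh t1 t2]; have fh := gh; rewrite flip_neq_k // in fh.
have nbd : [set x; z] != [set b; d].
  by apply: contra hk => /eqP e; apply/eqP/flip_inj; rewrite gh e /g /flip eqxx.
(* The rotation of a new triangle with [b] and [d] as first and last corners would make [h] the new
   diagonal; four of the six triples remain. *)
have aux x' y' z' : [set x'; z'] != [set b; d] -> (x', y', z') \in new_tris ->
    (x', y', z') \in [:: (a, b, d); (b, d, a); (c, d, b); (d, b, c)].
  move=> n; rewrite !inE => /or4P[->|->|e|]; rewrite ?orbT //.
    by move: e n => /eqP[-> _ ->]; rewrite setUC eqxx.
  by case/or3P => [e|->|->]; rewrite ?orbT //; move: e n => /eqP[-> _ ->]; rewrite eqxx.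
case: (tri_flip_cases t1) => [o1|/(aux _ _ _ nbd) n1];
  case: (tri_flip_cases t2) => [o2|n2].
- by rewrite /quad fh eqxx o1 o2.
- have : (z, w, x) \in [:: (a, b, d); (b, d, a); (c, d, b); (d, b, c)].
    by apply: aux n2; rewrite setUC.
  rewrite !inE /half_new => /or4P[] e; rewrite e ?orbT //; move: e o1 => /eqP[-> _ ->] ->;
    by rewrite ?orbT.
- move: n1; rewrite !inE /half_new => /or4P[] e; rewrite e ?orbT //; move: e o2 => /eqP[-> _ ->] ->;
    by rewrite ?orbT.
(* Two new triangles can be glued only along [bd], which is not the arc [h]. *)
- exfalso; have {}n2 : (z, w, x) \in [:: (a, b, d); (b, d, a); (c, d, b); (d, b, c)].
    by apply: aux n2; rewrite setUC.
  have := quad_points; rewrite !val_eqE.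
  case/and5P=> /eqP p1 /eqP p2 /eqP p3 /eqP p4 /andP[/eqP p5 /eqP p6].
  by move: n1 n2; rewrite !inE => /or4P[] /eqP[ex _ ez] /or4P[] /eqP[ez' _ ex']; congruence.
Qed.


(** * Invariants linking the framed quiver to the labelled triangulation *)

Definition at_edge (f : V -> {set 'I_N}) (l : V) (x y : 'I_N) : nat := f l == [set x; y].

(** The mutable part of [Q] is the quiver of the current triangulation: counterclockwise, [xz] is
    followed by [xy] or [zw] and preceded by [yz] or [wx] in its two triangles. *)
Definition exchange_inv (f : V -> {set 'I_N}) (Q : quiver (V + V)%type) :=
  forall h x y z w, quad f h x y z w -> forall l,
    Q (inl h) (inl l) = at_edge f l x y + at_edge f l z w /\
    Q (inl l) (inl h) = at_edge f l y z + at_edge f l w x.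

(* When X e counts the crossings with the shifted initial arc e, this says that
   the c-vector of h at e is half the tropical cross-ratio
   X yz + X wx - X xy - X zw of the quadrilateral around h. *)
Definition frozen_inv (f : V -> {set 'I_N}) (Q : quiver (V + V)%type)
    (X : V -> 'I_N -> 'I_N -> nat) :=
  forall h x y z w, quad f h x y z w -> forall e,
    (Q (inl h) (inr e)).*2 + X e x y + X e z w =
    (Q (inr e) (inl h)).*2 + X e y z + X e w x.

Section Mutation.
Variable (Q : quiver (V + V)%type).
Hypotheses (Qf : exchange_inv f Q).

Lemma at_edgeC f' l x y : at_edge f' l x y = at_edge f' l y x.
Proof. by rewrite /at_edge setUC. Qed.

Lemma at_edge_ac l : l != k -> at_edge f l a c = 0.
Proof.
move=> lk; rewrite /at_edge -fk; case: eqP => // /f_inj e.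
by rewrite e eqxx in lk.
Qed.

Lemma at_edge_flip l x y : l != k -> at_edge g l x y = at_edge f l x y.
Proof. by move=> lk; rewrite /at_edge flip_neq_k. Qed.

Lemma at_edge_bd l : l != k -> at_edge f l b d = 0.
Proof.
by move=> lk; rewrite /at_edge; case: eqP => // /edge_of_f e; case/negP: not_edge_bd.
Qed.

Lemma at_edge_k_old x y : edge f x y -> at_edge g k x y = 0.
Proof.
by move=> e; rewrite /at_edge flip_eq_k eq_sym (negbTE (edge_ac_bd e)).
Qed.

Lemma at_edge_k_bd : at_edge g k b d = 1.
Proof. by rewrite /at_edge flip_eq_k eqxx. Qed.

(** Arrow counts after adding paths and reversing, but before cancelling 2-cycles, for [h] different
    from [k]. *)
Definition arrows_after h l := if l == k then Q (inl l) (inl h)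
  else Q (inl h) (inl l) + Q (inl h) (inl k) * Q (inl k) (inl l).
Definition arrows_into_after h l := if l == k then Q (inl h) (inl l)
  else Q (inl l) (inl h) + Q (inl l) (inl k) * Q (inl k) (inl h).

(** Cancellation is a truncated subtraction, so the invariant is first shown as an equality of
    differences, written additively. *)
Definition balanced h x y z w := forall l,
  arrows_after h l + at_edge g l y z + at_edge g l w x =
  arrows_into_after h l + at_edge g l x y + at_edge g l z w.

(** For [h = da] the new paths are [h -> k -> l], for [h = ab] they are [l -> k -> h]; they replace
    the apex [c] of the old quadrilateral around [h] by [b] or [d]. *)
Lemma half_new_balanced h x y z w : h != k -> f h = [set x; z] ->
  half_new a b c d x y z w -> balanced h x y z w.
Proof.
move=> hk fh; case/and4P: (tabc) => _ eab ebc eca; case/and4P: (tcda) => _ ecd eda _.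
case/orP => /andP[/eqP[? ? ?]]; subst x y z; move=> t l.
- have q : quad f h a c d w by rewrite /quad fh eqxx t (tri_rot (tri_rot tcda)).
  case/and4P: t => _ edw ewa _.
  have [h1 h2] := Qf q l; have [h3 h4] := Qf kq l; have [h5 h6] := Qf kq h.
  have {h5 h6}[h5 h6] : Q (inl k) (inl h) = 0 /\ Q (inl h) (inl k) = 1.
    rewrite h5 h6 /at_edge fh !eq_set2; have := quad_points.
    by clear; lia.
  rewrite /arrows_after /arrows_into_after; case: eqP => [->|/eqP lk].
    by rewrite h5 h6 at_edge_k_bd !at_edge_k_old.
  rewrite h1 h2 h3 h4 h5 h6 !at_edge_flip // at_edge_ac // at_edge_bd //.
  by clear; lia.
- have q : quad f h b c a w by rewrite /quad fh setUC eqxx t (tri_rot tabc).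
  case/and4P: t => _ eaw ewb _.
  have [h1 h2] := Qf q l; have [h3 h4] := Qf kq l; have [h5 h6] := Qf kq h.
  have {h5 h6}[h5 h6] : Q (inl k) (inl h) = 1 /\ Q (inl h) (inl k) = 0.
    rewrite h5 h6 /at_edge fh !eq_set2; have := quad_points.
    by clear; lia.
  rewrite /arrows_after /arrows_into_after; case: eqP => [->|/eqP lk].
    by rewrite h5 h6 at_edge_k_bd !at_edge_k_old.
  rewrite h1 h2 h3 h4 h5 h6 !at_edge_flip // (at_edgeC _ _ c a) at_edge_ac // at_edge_bd //.
  by clear; lia.
Qed.

Variables (X : V -> 'I_N -> 'I_N -> nat).
Hypotheses (QX : frozen_inv f Q X) (Xsym : forall e x y, X e x y = X e y x)
  (Qgreen : forall e, Q (inr e) (inl k) = 0)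
  (Xac_bd : forall e, X e a c + X e b d = X e b c + X e d a).

Definition frozen_balanced h x y z w := forall e,
  (Q (inl h) (inr e) + Q (inl h) (inl k) * Q (inl k) (inr e)).*2 + X e x y + X e z w =
  (Q (inr e) (inl h)).*2 + X e y z + X e w x.

(** As [k] is green, no path through it starts at a frozen vertex, so only arrows towards frozen
    vertices are added; [Xac_bd] trades the crossings with [bd] for those with old edges. *)
Lemma half_new_frozen h x y z w : h != k -> f h = [set x; z] ->
  half_new a b c d x y z w -> frozen_balanced h x y z w.
Proof.
move=> hk fh.
case/orP => /andP[/eqP[? ? ?]]; subst x y z; move=> t e; have := Xac_bd e.
- have q : quad f h a c d w by rewrite /quad fh eqxx t (tri_rot (tri_rot tcda)).
  have := QX q e; have := QX kq e; rewrite Qgreen; have [h5 h6] := Qf kq h.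
  have -> : Q (inl h) (inl k) = 1.
    rewrite h6 /at_edge fh !eq_set2; have := quad_points.
    by clear; lia.
  by clear; lia.
- have q : quad f h b c a w by rewrite /quad fh setUC eqxx t (tri_rot tabc).
  have := QX q e; have [h5 h6] := Qf kq h; rewrite (Xsym e c a).
  have -> : Q (inl h) (inl k) = 0.
    rewrite h6 /at_edge fh !eq_set2; have := quad_points.
    by clear; lia.
  by clear; lia.
Qed.

End Mutation.
End Flip.
End Polygon.

Lemma balanced_sub p q m n : n * m = 0 -> p + m = q + n -> p - q = n /\ q - p = m.
Proof. by move=> /eqP; rewrite muln_eq0 => /orP[] /eqP->; lia. Qed.

(** * Mutation at a green vertex carries the invariants across a flip *)

Section MutationFlip.
Variables (N : nat) (V : finType).
Implicit Types (f : V -> {set 'I_N}) (Q : quiver (V + V)%type) (x y z w : 'I_N).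

Lemma inl_eq (h k : V) : (inl h == inl k :> (V + V)%type) = (h == k).
Proof. by []. Qed.

Lemma quad_excl f h x y z w l : quad f h x y z w ->
  (at_edge f l x y + at_edge f l z w) * (at_edge f l y z + at_edge f l w x) = 0.
Proof.
move=> /quad_points p; rewrite /at_edge.
case: (f l =P [set x; y]) => [->|_].
  by move: p; rewrite !eq_set2; clear; lia.
case: (f l =P [set z; w]) => [->|_]; last by [].
by move: p; rewrite !eq_set2; clear; lia.
Qed.

Lemma mutation_neq Q h k l : h != k -> Q (inl k) (inl k) = 0 ->
  mutation (inl k) Q (inl h) (inl l) = arrows_after k Q h l - arrows_into_after k Q h l /\
  mutation (inl k) Q (inl l) (inl h) = arrows_into_after k Q h l - arrows_after k Q h l.
Proof.
move=> /negbTE hk Qkk.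
rewrite /mutation /cancel_2cycles /reverse_at /add_paths /arrows_after /arrows_into_after.
rewrite !inl_eq hk /=; case: eqP => [->|_] //=.
by rewrite Qkk muln0 mul0n !addn0.
Qed.

Lemma mutation_at Q k v : Q (inl k) (inl k) = 0 ->
  mutation (inl k) Q (inl k) v = Q v (inl k) - Q (inl k) v /\
  mutation (inl k) Q v (inl k) = Q (inl k) v - Q v (inl k).
Proof.
move=> Qkk; rewrite /mutation /cancel_2cycles /reverse_at /add_paths !eqxx orbT /=.
by rewrite Qkk muln0 mul0n !addn0.
Qed.

Lemma exchange_inv_loop f Q k a b c d : quad f k a b c d -> exchange_inv f Q ->
  Q (inl k) (inl k) = 0.
Proof.
move=> q Qf; have [-> _] := Qf _ _ _ _ _ q k.
have p := quad_points q; case/and3P: q => /eqP fk _ _.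
by move: p; rewrite /at_edge fk !eq_set2; clear; lia.
Qed.

Section AtFlip.
Variables (f : V -> {set 'I_N}) (k : V) (a b c d : 'I_N).
Hypotheses (f_inj : injective f) (f_nc : noncrossing f) (kq : quad f k a b c d).
Let g := flip f k [set b; d].
Let kq' : quad f k c d a b. Proof. exact: quad_rot. Qed.
Let gE : flip f k [set d; b] = g. Proof. by rewrite /g setUC. Qed.

Variable Q : quiver (V + V)%type.
Hypothesis Qf : exchange_inv f Q.

Lemma quad_flip_old h x y z w : h != k -> quad f h x y z w -> quad g h x y z w ->
  [/\ edge f x y, edge f y z, edge f z w & edge f w x] /\
  Q (inl h) (inl k) = 0 /\ Q (inl k) (inl h) = 0.
Proof.
move=> hk q /and3P[_ /and4P[_ e1 e2 _] /and4P[_ e3 e4 _]].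
have [h1 h2] := Qf q k; case/and3P: q => _ /and4P[_ ? ? _] /and4P[_ ? ? _].
split=> //; rewrite h1 h2 /at_edge; have /and3P[/eqP-> _ _] := kq.
by rewrite !(eq_sym [set a; c]) !(negbTE (flip_edge_ac f_inj f_nc kq _)).
Qed.

Lemma balancedC h x y z w : balanced f k b d Q h z w x y -> balanced f k b d Q h x y z w.
Proof. by move=> H l; have := H l; clear; lia. Qed.

Lemma flip_balanced h x y z w : h != k -> quad g h x y z w ->
  balanced f k b d Q h x y z w.
Proof.
move=> hk q; have fh : f h = [set x; z].
  by case/and3P: q => /eqP; rewrite /g flip_neq_k.
have fh' : f h = [set z; x] by rewrite setUC.
case/or4P: (quad_flip_neq f_inj f_nc kq hk q) => [q'|n|n|/orP[] n].
- move=> l; have [[e1 e2 e3 e4] [q1 q2]] := quad_flip_old hk q' q.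
  rewrite /arrows_after /arrows_into_after q1 q2; case: eqP => [->|/eqP lk].
    by rewrite q1 q2 !(at_edge_k_old f_nc kq).
  rewrite !at_edge_flip //; have [-> ->] := Qf q' l.
  by clear; lia.
- exact: half_new_balanced n.
- by have := half_new_balanced f_inj f_nc kq' Qf hk fh n; rewrite /balanced gE.
- by apply: balancedC; apply: half_new_balanced n.
- by apply: balancedC; have := half_new_balanced f_inj f_nc kq' Qf hk fh' n; rewrite /balanced gE.
Qed.

Lemma flip_exchange_inv : exchange_inv g (mutation (inl k) Q).
Proof.
have Qkk := exchange_inv_loop kq Qf.
move=> h x y z w q l; have ex := quad_excl l q.
have [ehk | hk] := eqVneq h k; last first.
  have [-> ->] := mutation_neq l hk Qkk.
  by apply: balanced_sub ex _; rewrite !addnA; apply: flip_balanced hk q l.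
rewrite ehk in q *; have [-> ->] := mutation_at (inl l) Qkk.
case/and3P: (kq) => _ /and4P[_ eab ebc _] /and4P[_ ecd eda _].
have [elk | lk] := eqVneq l k.
  rewrite elk Qkk subnn.
  by case: (quad_flip_k f_inj f_nc kq q) => -[-> -> -> ->]; rewrite !(at_edge_k_old f_nc kq).
have [-> ->] := Qf kq l; move: ex; rewrite !(at_edge_flip f b d _ _ lk).
by case: (quad_flip_k f_inj f_nc kq q) => -[-> -> -> ->]; move=> /balanced_sub; apply; ring.
Qed.


Lemma flip_quads : (forall h, exists x y z w, quad f h x y z w) ->
  forall h, exists x y z w, quad g h x y z w.
Proof.
have [gabd gbcd] := flip_tris kq.
have [tabc tcda] : tri f a b c /\ tri f c d a by case/and3P: kq.
(* A triangle on [zx] that contains [ac] is one of the two destroyed ones; its replacement on [zx]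
   has apex [b] or [d]. *)
have side_tri x y z : tri f x y z -> [set z; x] != [set a; c] ->
    exists y', tri g x y' z.
  move=> t zx; have [/eqP|xy] := boolP ([set x; y] == [set a; c]).
    move=> /eqP; rewrite eq_set2 => /orP[] /andP[/eqP/val_inj ? /eqP/val_inj ?]; subst x y.
      exists b; have <- // := tri_apex f_nc (tri_rot (tri_rot tcda)) t.
    by exists d; have <- := tri_apex f_nc (tri_rot (tri_rot tabc)) t; apply: tri_rot.
  have [/eqP|yz] := boolP ([set y; z] == [set a; c]).
    move=> /eqP; rewrite eq_set2 => /orP[] /andP[/eqP/val_inj ? /eqP/val_inj ?]; subst y z.
      have <- := tri_apex f_nc (tri_rot (tri_rot tcda)) (tri_rot t).
      by exists b; apply/tri_rot/tri_rot.
    have <- := tri_apex f_nc (tri_rot (tri_rot tabc)) (tri_rot t).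
    by exists d; apply: tri_rot.
  by exists y; apply: (tri_flip kq).
move=> quads h; have [->|hk] := eqVneq h k.
  by exists b, c, d, a; apply: quad_flip_self.
have [x [y [z [w /and3P[/eqP fh t1 t2]]]]] := quads h.
have nzx : [set z; x] != [set a; c].
  rewrite setUC -fh; apply: contra hk => /eqP e; apply/eqP/f_inj; rewrite e.
  by case/and3P: kq => /eqP.
have [y' t1'] := side_tri _ _ _ t1 nzx.
have [|w' t2'] := side_tri _ _ _ t2; first by rewrite setUC.
by exists x, y', z, w'; rewrite /quad t1' t2' /g flip_neq_k // fh eqxx.
Qed.

Variables (X : V -> 'I_N -> 'I_N -> nat).
Hypotheses (QX : frozen_inv f Q X) (Xsym : forall e x y, X e x y = X e y x)
  (Qgreen : forall e, Q (inr e) (inl k) = 0)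
  (Xac_bd : forall e, X e a c + X e b d = X e b c + X e d a).

Lemma frozen_balancedC h x y z w : frozen_balanced k Q X h z w x y ->
  frozen_balanced k Q X h x y z w.
Proof. by move=> H l; have := H l; clear; lia. Qed.

(** The crossing numbers [X] stay fixed; the change of the c-vectors comes entirely from the change
    of the quadrilaterals. *)
Lemma flip_frozen_inv : frozen_inv g (mutation (inl k) Q) X.
Proof.
have Qkk := exchange_inv_loop kq Qf.
move=> h x y z w q e.
have [ehk | hk] := eqVneq h k.
  rewrite ehk in q *; have [-> ->] := mutation_at (inr e) Qkk; rewrite Qgreen sub0n subn0.
  have := QX kq e; rewrite Qgreen.
  by case: (quad_flip_k f_inj f_nc kq q) => -[-> -> -> ->]; clear; lia.
have fh : f h = [set x; z].
  by case/and3P: q => /eqP; rewrite /g flip_neq_k.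
have fh' : f h = [set z; x] by rewrite setUC.
have Xca_db e' : X e' c a + X e' d b = X e' d a + X e' b c.
  by rewrite Xsym (Xsym _ d b) Xac_bd addnC.
suff: frozen_balanced k Q X h x y z w.
  move=> /(_ e); rewrite /mutation /cancel_2cycles /reverse_at /add_paths !inl_eq.
  rewrite (negbTE hk) /= Qgreen mul0n addn0.
  by clear; lia.
case/or4P: (quad_flip_neq f_inj f_nc kq hk q) => [q'|n|n|/orP[] n].
- move=> e'; have [_ [-> _]] := quad_flip_old hk q' q.
  by rewrite mul0n addn0; apply: QX.
- exact: half_new_frozen n.
- exact: half_new_frozen n.
- by apply: frozen_balancedC; apply: half_new_frozen n.
- by apply: frozen_balancedC; apply: half_new_frozen n.
Qed.

End AtFlip.
End MutationFlip.

Lemma joinsC p q r s x y : joins p q r s x y = joins p q r s y x.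
Proof. by rewrite /joins_for orbC. Qed.

Lemma joins_rot p q r s x y : joins p q r s x y = joins r s p q x y.
Proof. by rewrite /joins_for orbC; congr (_ || _); rewrite andbC. Qed.

Lemma eq_forE x y : eq_for lt_nat x y = (x == y).
Proof. by apply/eq_forP/eqP. Qed.

Definition join_set N (p q r s : 'I_N) (E : {set 'I_N}) : bool :=
  [exists x : 'I_N, exists y : 'I_N, (E == [set x; y]) && joins p q r s x y].

Lemma join_setE N (p q r s x y : 'I_N) :
  join_set p q r s [set x; y] = joins p q r s x y.
Proof.
apply/existsP/idP => [[x' /existsP[y' /andP[]]]|j]; last first.
  by exists x; apply/existsP; exists y; rewrite eqxx.
rewrite eq_set2 => /orP[] /andP[/eqP-> /eqP->] //.
by rewrite joinsC.
Qed.

Lemma join_setP N (p q r s : 'I_N) E : join_set p q r s E ->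
  exists x y, E = [set x; y] /\ joins p q r s x y.
Proof. by case/existsP => x /existsP[y /andP[/eqP-> j]]; exists x, y. Qed.

Lemma joins_ends p q r s x y : joins p q r s x y ->
  exists x' y', [/\ inn p q x', inn r s y' & (x', y') = (x, y) \/ (x', y') = (y, x)].
Proof. by case/orP => /andP[h1 h2]; [exists x, y | exists y, x]; split; auto. Qed.

(** * Shear coordinates *)

Section Shear.
Import GRing.Theory Num.Theory.
Variables (N : nat) (V : finType) (f0 : V -> {set 'I_N}).
Hypotheses (f0_inj : injective f0) (f0_nc : noncrossing f0).
Variables (p q r s : V -> 'I_N).
Hypothesis (f0_quad : forall i, quad f0 i (p i) (q i) (r i) (s i)).

Implicit Types (f : V -> {set 'I_N}) (a b c d u v x y z w : 'I_N).

(* The shear coordinate at the arc i of the initial triangulation: E, moved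
   slightly counterclockwise, may join opposite sides of the quadrilateral
   around i, and the pair of sides determines the sign. *)
Definition shear (i : V) (E : {set 'I_N}) : int :=
  (Posz (join_set (p i) (q i) (r i) (s i) E) - Posz (join_set (q i) (r i) (s i) (p i) E))%R.

Definition separates (e : V) (x y : 'I_N) : nat := sep (p e) (r e) x y.

Lemma separatesC e x y : separates e x y = separates e y x.
Proof. by rewrite /separates /sep_for addbC. Qed.

Lemma quad_cycs f i x y z w : quad f i x y z w -> cyc x y z /\ cyc z w x.
Proof. by case/and3P => _ /and4P[-> _ _ _] /and4P[-> _ _ _]. Qed.

Lemma quad_edges f i x y z w : quad f i x y z w ->
  [/\ edge f x y, edge f y z, edge f z w & edge f w x].
Proof. by case/and3P => _ /and4P[_ -> -> _] /and4P[_ -> -> _]. Qed.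

Lemma quad_diag f i x y z w : quad f i x y z w -> f i = [set x; z].
Proof. by case/and3P => /eqP. Qed.

Lemma quad_unique f i x y z w x' y' z' w' : noncrossing f ->
  quad f i x y z w -> quad f i x' y' z' w' ->
  (x', y', z', w') = (x, y, z, w) \/ (x', y', z', w') = (z, w, x, y).
Proof.
move=> nf /and3P[/eqP fi t1 t2] /and3P[]; rewrite fi eq_set2.
move=> /orP[] /andP[/eqP/val_inj <- /eqP/val_inj <-] t3 t4; [left|right].
  rewrite (tri_apex nf (tri_rot (tri_rot t1)) (tri_rot (tri_rot t3))).
  by rewrite (tri_apex nf (tri_rot (tri_rot t2)) (tri_rot (tri_rot t4))).
rewrite (tri_apex nf (tri_rot (tri_rot t1)) (tri_rot (tri_rot t4))).
by rewrite (tri_apex nf (tri_rot (tri_rot t2)) (tri_rot (tri_rot t3))).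
Qed.

(** The quadrilateral around an arc is unique up to a half turn, which preserves each pair of
    opposite sides. *)
Lemma shearE i x y z w E : quad f0 i x y z w ->
  shear i E = (Posz (join_set x y z w E) - Posz (join_set y z w x E))%R.
Proof.
case/(quad_unique f0_nc (f0_quad i)) => -[-> -> -> ->] //.
have jr a b c d : join_set a b c d E = join_set c d a b E.
  by apply: eq_existsb => x'; apply: eq_existsb => y'; rewrite joins_rot.
by rewrite /shear jr (jr (q i)).
Qed.

Lemma edge_exchange f k a b c d u v : quad f k a b c d ->
  (forall e, separates e a c + separates e b d = separates e b c + separates e d a) ->
  edge f0 u v -> u != v :> nat ->
  sep u v a c + sep u v b d = sep u v b c + sep u v d a.
Proof.
move=> /quad_cycs[h1 h2] ex /orP[side|/existsP[e e_uv]] uv.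
  have nc (z w : 'I_N) : ~~ cross z w u v by rewrite cross_sym; apply: side_noncrossing.
  exact: noncrossing_exchange.
move: e_uv; rewrite (quad_diag (f0_quad e)) eq_set2 => /orP[] /andP[/eqP e1 /eqP e2]; have := ex e;
  rewrite /separates e1 e2 //.
by rewrite !(@sep_sym u v).
Qed.

(** By [sep_joins] a shear coordinate is half a signed sum of crossing numbers with the edges of the
    quadrilateral around [i], and the exchange relation holds for each of these edges. *)
Lemma shear_exchange f k a b c d i : quad f k a b c d ->
  (forall e, separates e a c + separates e b d = separates e b c + separates e d a) ->
  (shear i [set a; c] + shear i [set b; d] = shear i [set b; c] + shear i [set d; a])%R.
Proof.
move=> kq ex; have [h1 h2] := quad_cycs (f0_quad i).
have [e1 e2 e3 e4] := quad_edges (f0_quad i).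
have /and3P[n1 n2 _] := cyc_uniq h1; have /and3P[n3 n4 _] := cyc_uniq h2.
have := edge_exchange kq ex e1 n1; have := edge_exchange kq ex e2 n2.
have := edge_exchange kq ex e3 n3; have := edge_exchange kq ex e4 n4.
rewrite /shear !join_setE.
have := sep_joins a c h1 h2; have := sep_joins b d h1 h2.
have := sep_joins b c h1 h2; have := sep_joins d a h1 h2.
by clear; lia.
Qed.

Lemma shear_noncrossing i (x y : 'I_N) : x != y :> nat ->
  (forall z w : 'I_N, edge f0 z w -> ~~ cross z w x y) ->
  shear i [set x; y] = Posz (f0 i == [set x; y]).
Proof.
move=> xy nc; have [h1 h2] := quad_cycs (f0_quad i).
have [e1 e2 e3 e4] := quad_edges (f0_quad i); have fi := quad_diag (f0_quad i).
have /andP[n /eqP j] := joins_noncrossing h1 h2 xy (nc _ _ e1) (nc _ _ e2)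
  (nc _ _ e3) (nc _ _ e4) (nc _ _ (edge_of_f fi)).
rewrite /shear !join_setE (negbTE n) j fi eq_set2 subr0.
by rewrite !eq_forE.
Qed.

Lemma shear_side i (x y : 'I_N) : is_side [set x; y] -> x != y :> nat ->
  shear i [set x; y] = Posz 0.
Proof.
move=> side xy; rewrite shear_noncrossing //; last first.
  by move=> z w _; rewrite cross_sym side_noncrossing.
case: eqP => // fi; have [h1 h2] := quad_cycs (f0_quad i).
move: side; rewrite -fi (quad_diag (f0_quad i)) => /(@side_noncrossing _ _ _ (q i) (s i)).
by rewrite cross_sym diagonals_cross.
Qed.

Lemma shear_initial i h : shear i (f0 h) = Posz (i == h).
Proof.
rewrite (quad_diag (f0_quad h)) shear_noncrossing.
- by rewrite -(quad_diag (f0_quad h)) (inj_eq f0_inj).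
- by have [/cyc_uniq/and3P[_ _]] := quad_cycs (f0_quad h); rewrite eq_sym.
- by move=> z w e; apply: edge_noncrossing e (edge_of_f (quad_diag (f0_quad h))).
Qed.

Lemma shear_gt0 i x y z w E : quad f0 i x y z w -> (0 < shear i E)%R -> join_set x y z w E.
Proof. by move=> iq; rewrite (shearE _ iq); case: (join_set x y z w E) => //=; lia. Qed.

Lemma shear_lt0 i x y z w E : quad f0 i x y z w -> (shear i E < 0)%R -> join_set y z w x E.
Proof. by move=> iq; rewrite (shearE _ iq); case: (join_set y z w x E) => //=; lia. Qed.

(** Opposite signs would come from two arcs joining different pairs of opposite sides, and such arcs
    cross. *)
Lemma shear_coherent f i h l : noncrossing f ->
  (0 < shear i (f h))%R -> (shear i (f l) < 0)%R -> False.
Proof.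
move=> nf /(shear_gt0 (f0_quad i))/join_setP[x [y [fh j1]]].
move=> /(shear_lt0 (f0_quad i))/join_setP[z [w [fl j2]]].
have [h1 h2] := quad_cycs (f0_quad i).
by have := nf _ _ _ _ _ _ fh fl; rewrite (joins_cross h1 h2 j1 j2).
Qed.

Lemma quad_of_tri i A B C : tri f0 A B C -> f0 i = [set A; B] ->
  exists D, quad f0 i B C A D.
Proof.
move=> t fi; have := f0_quad i => /and3P[/eqP fi' t1 t2].
move: (fi') => /eqP; rewrite fi eq_set2 => /orP[] /andP[/eqP/val_inj e1 /eqP/val_inj e2];
  move: t1 t2; rewrite -?e1 -?e2 => t1 t2.
  exists (q i); apply: quad_rot; rewrite /quad fi eqxx t1 /=.
  by rewrite (tri_apex f0_nc t (tri_rot (tri_rot t2))).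
exists (s i); rewrite /quad fi setUC eqxx t2 andbT /=.
by rewrite (tri_apex f0_nc t (tri_rot (tri_rot t1))).
Qed.

(* The arcs i = AB and j = BC cut the polygon, up to the choice of D and E,
   along a pentagon A D B E C; the shear vector at (i, j) of a diagonal joining
   two of its five sides is one of (1,0), (0,1), (-1,0), (0,-1), (1,-1). *)
Lemma shear_pentagon f i j A B C h l : noncrossing f ->
  tri f0 A B C -> f0 i = [set A; B] -> f0 j = [set B; C] ->
  (forall m, 0 <= shear i (f m) /\ shear j (f m) <= 0)%R ->
  (0 < shear i (f h) + shear j (f h))%R ->
  (shear i (f l) + shear j (f l) < 0)%R -> False.
Proof.
move=> nf t fi fj sgn hpos lneg.
have [D qi] := quad_of_tri t fi; have [E qj] := quad_of_tri (tri_rot t) fj.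
have [ci1 ci2] := quad_cycs qi; have [cj1 cj2] := quad_cycs qj.
(* The [j] coordinate is at most 0, so a positive sum needs a positive [i] coordinate; the arc joins
   [BC] to [AD]. *)
have hi : (0 < shear i (f h))%R by have := sgn h; move: hpos; clear; lia.
have /join_setP[x [y [fh /joins_ends[x' [y' [hx hy hxy]]]]]] := shear_gt0 qi hi.
have lj : (shear j (f l) < 0)%R by have := sgn l; move: lneg; clear; lia.
have /join_setP[z [w [fl /joins_ends[z' [w' [hz hw hzw]]]]]] := shear_lt0 qj lj.
(* Beyond [E] the arc would also join [AB] to [EC], making its [j] coordinate -1 and the sum 0. The
   argument for [z'] is symmetric. *)
have x1 : inn B E x'.
  move: hx; rewrite (inn_join x' cj2) => /orP[//|hx].
  have j24 : joins A B E C x y.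
    have hyB : inn A B y' by rewrite (inn_join y' ci2) hy.
    by case: hxy => -[<- <-]; rewrite /joins_for hyB hx ?orbT.
  have /negbTE j13 : ~~ joins C A B E x y by apply: contraL j24; apply: joins_excl.
  move: hpos; rewrite (shearE _ qi) (shearE _ qj) fh !join_setE j13 j24.
  by case: (joins B C A D x y); case: (joins C A D B x y).
have z1 : inn D B z'.
  move: hz; rewrite (inn_join z' ci2) => /orP[hz|//].
  have j13 : joins B C A D z w.
    have hwC : inn B C w' by rewrite (inn_join w' cj2) hw orbT.
    by case: hzw => -[<- <-]; rewrite /joins_for hwC hz ?orbT.
  have /negbTE j24 := joins_excl ci1 ci2 j13.
  move: lneg; rewrite (shearE _ qi) (shearE _ qj) fl !join_setE j13 j24.
  by case: (joins C A B E z w); case: (joins A B E C z w).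
(* The ends of the two arcs alternate in the order [y'], [z'], [x'], [w']. *)
have c1 : cyc y' z' x'.
  by apply: (inn_cyc ci2 hy z1); rewrite (inn_join x' ci1) hx.
have c2 : cyc x' w' y'.
  by apply: (inn_cyc cj2 x1 hw); rewrite (inn_join y' cj1) (inn_join y' ci2) hy orbT.
have : cross x y z w.
  have : cross x' y' z' w' by rewrite /cross_for c1 c2 orbT.
  by case: hxy => -[<- <-]; case: hzw => -[<- <-] //;
    rewrite ?(cross_flipl y') // (cross_flipr _ _ w').
by apply/negP/(nf _ _ _ _ _ _ fh fl).
Qed.

End Shear.

(** * Counting the steps of a green sequence *)

Section GreenSteps.
Import Order.TTheory GRing.Theory Num.Theory.
Local Open Scope ring_scope.
Variables (V : finType) (m : nat) (k : nat -> V).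
Variables (c g : nat -> V -> V -> int) (w : nat -> V -> int).
Hypotheses (c0 : forall h e, c 0 h e = (h == e)%:R)
  (cS : forall t h e, (t < m)%N -> c t.+1 h e =
     if h == k t then - c t h e else c t h e + w t h * c t (k t) e)
  (c_green : forall t e, (t < m)%N -> 0 <= c t (k t) e)
  (c_red : forall h e, c m h e <= 0)
  (g0 : forall i h, g 0 i h = (i == h)%:R)
  (gS : forall t i h, (t < m)%N -> g t.+1 i h =
     if h == k t then - g t i h + \sum_l w t l * g t i l else g t i h)
  (w_self : forall t, (t < m)%N -> w t (k t) = 0)
  (g_coherent : forall t i h l, (t <= m)%N -> 0 < g t i h -> g t i l < 0 -> False).

(** The pairing is invariant under each step: the multiples of [c t (k t) e] gained at the other
    indices cancel against the sum gained by [g] at [k t]. *)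
Lemma dual_bases t i e : (t <= m)%N -> \sum_h g t i h * c t h e = (i == e)%:R.
Proof.
elim: t => [_|t IH tm].
  rewrite (bigD1 i) //= big1 ?addr0 ?g0 ?c0 ?eqxx ?mul1r // => h hi.
  by rewrite g0 eq_sym (negbTE hi) mul0r.
rewrite -(IH (ltnW tm)) (bigD1 (k t)) //= [RHS](bigD1 (k t)) //=.
rewrite gS // cS // eqxx (bigD1 (k t)) //= w_self // mul0r add0r.
have -> : \sum_(h | h != k t) g t.+1 i h * c t.+1 h e =
    \sum_(h | h != k t) g t i h * c t h e +
    (\sum_(h | h != k t) w t h * g t i h) * c t (k t) e.
  rewrite mulr_suml -big_split; apply: eq_bigr => h /negbTE hk /=.
  by rewrite gS // cS // hk; ring.
ring.
Qed.

Definition nonneg t i := [forall h, 0 <= g t i h].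
Definition support t : {set V} := [set e | c t (k t) e != 0].

Lemma nonnegP t i h : nonneg t i -> 0 <= g t i h. Proof. by move/forallP. Qed.

Lemma nonneg_nonpos t i h : (t <= m)%N -> ~~ nonneg t i -> g t i h <= 0.
Proof.
move=> tm /forallPn[l]; rewrite -ltNge => gl; rewrite leNgt; apply/negP => gh.
exact: g_coherent gh gl.
Qed.

(* If the mutation changes the sign of all coordinates at once, then only the
   coordinate at the mutated vertex was nonzero. *)
Lemma sign_change (r r' lam : V -> int) t :
  (forall e, \sum_h r h * c t h e = lam e) ->
  (forall h, h != k t -> r' h = r h) ->
  (forall h, 0 <= r h) -> (forall h, r' h <= 0) ->
  (forall h, h != k t -> r h = 0) /\ forall e, lam e = r (k t) * c t (k t) e.
Proof.
move=> dual same pos neg.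
have z h : h != k t -> r h = 0.
  by move=> hk; apply/eqP; rewrite eq_le pos -(same h hk) neg.
split=> // e; rewrite -dual (bigD1 (k t)) //= big1 ?addr0 // => h hk.
by rewrite z // mul0r.
Qed.

Lemma support_of_multiple (lam : V -> int) t x i :
  (forall e, lam e = x * c t (k t) e) -> lam i != 0 ->
  support t = [set e | lam e != 0].
Proof.
move=> lamE; rewrite lamE mulf_eq0 negb_or => /andP[x0 _].
by apply/setP=> e; rewrite !inE lamE mulf_eq0 (negbTE x0).
Qed.

(** A return to nonnegative would write 1 as the product of a nonpositive coordinate and an entry of
    a green c-vector. *)
Lemma nonneg_monotone t i : (t < m)%N -> nonneg t.+1 i -> nonneg t i.
Proof.
move=> tm pos; apply: contraLR pos => npos; apply/negP => pos.
have [] := @sign_change (fun h => - g t i h) (fun h => - g t.+1 i h) (fun e => - (i == e)%:R) t.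
- by move=> e; rewrite -(dual_bases i e (ltnW tm)) -sumrN; apply: eq_bigr => h _; rewrite mulNr.
- by move=> h /negbTE hk; rewrite gS // hk.
- by move=> h; rewrite oppr_ge0; apply: nonneg_nonpos npos; apply: ltnW.
- by move=> h; rewrite oppr_le0; apply: nonnegP.
move=> _ /(_ i); rewrite eqxx /=.
have := nonneg_nonpos (k t) (ltnW tm) npos; have := c_green i tm.
by move: (c t _ _) (g t _ _) => x y; nia.
Qed.

(** The row starts nonnegative and cannot end so, since it pairs to 1 with the final, nonpositive
    c-vectors. The step [tau] starts at the last time the row is nonnegative. *)
Lemma simple_step i : exists tau, [/\ (tau < m)%N,
  forall t, (t <= m)%N -> nonneg t i = (t <= tau)%N, support tau = [set i] &
  forall h, h != k tau -> g tau i h = 0].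
Proof.
have pos0 : nonneg 0 i by apply/forallP => h; rewrite g0 ler0n.
have neg_m : ~~ nonneg m i.
  apply/negP => pos; have := dual_bases i i (leqnn m); rewrite eqxx => e.
  suff : (1 : int) <= 0 by [].
  rewrite -[X in X <= _]e; apply: sumr_le0 => h _.
  by apply: mulr_ge0_le0; [apply: nonnegP | apply: c_red].
have [n neg_n min_n] := ex_minnP (ex_intro (fun t => ~~ nonneg t i) m neg_m).
have n_m : (n <= m)%N by apply: min_n.
case: n => [|tau] in neg_n min_n n_m *; first by rewrite pos0 in neg_n.
have pos_tau t : (t <= tau)%N -> nonneg t i.
  by rewrite -ltnS ltnNge; apply: contraNT => /min_n.
have neg_after t : (tau < t)%N -> (t <= m)%N -> ~~ nonneg t i.
  elim: t => // t IH; rewrite ltnS leq_eqVlt => /orP[/eqP<- //|lt] tm.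
  by apply: contra (IH lt (ltnW tm)); apply: nonneg_monotone.
have [] := @sign_change (g tau i) (g tau.+1 i) (fun e => (i == e)%:R) tau.
- by move=> e; apply: dual_bases; apply: ltnW.
- by move=> h /negbTE hk; rewrite gS // hk.
- by move=> h; apply: nonnegP; apply: pos_tau.
- by move=> h; apply: nonneg_nonpos neg_n.
move=> z mult; exists tau; split=> //.
  move=> t tm; apply/idP/idP; last exact: pos_tau.
  by move=> pos; rewrite leqNgt; apply: contraL pos => /neg_after; apply.
rewrite (support_of_multiple mult (i := i)) ?eqxx //.
by apply/setP=> e; rewrite !inE pnatr_eq0 eqb0 negbK eq_sym.
Qed.

(** This is the property that an arrow [i -> j] of the initial quiver supplies. *)
Definition compatible i j := forall t, (t <= m)%N ->
  (forall h, 0 <= g t i h /\ g t j h <= 0) ->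
  forall h l, 0 < g t i h + g t j h -> g t i l + g t j l < 0 -> False.

Lemma pair_step i j taui tauj : i != j -> compatible i j ->
  (taui < m)%N -> (forall t, (t <= m)%N -> nonneg t i = (t <= taui)%N) ->
  support taui = [set i] -> (forall h, h != k taui -> g taui i h = 0) ->
  (forall t, (t <= m)%N -> nonneg t j = (t <= tauj)%N) ->
  support tauj = [set j] -> (forall h, h != k tauj -> g tauj j h = 0) ->
  (tauj < taui)%N -> exists2 t, (t < m)%N & support t = [set i; j].
Proof.
move=> ij compat im pos_i supp_i zi pos_j supp_j zj lt_ji.
have sgn t : (tauj < t <= taui)%N -> forall h, 0 <= g t i h /\ g t j h <= 0.
  move=> /andP[h1 h2] h; have tm : (t <= m)%N by apply: leq_trans h2 (ltnW im).
  split; first by apply: nonnegP; rewrite pos_i.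
  by apply: nonneg_nonpos; rewrite // pos_j // -ltnNge.
have cvanish t e e' : support t = [set e] -> e' != e -> c t (k t) e' = 0.
  by move=> st ne; apply/eqP; move: ne; rewrite -in_set1 -st inE negbK.
(* If row [e'] lived only at [k t], its pairing at [e'] would be 0 instead of 1, because the support
   misses [e']. *)
have nonzero t e e' : (t < m)%N -> support t = [set e] -> e' != e ->
    exists2 h, h != k t & g t e' h != 0.
  move=> tm st ne; suff /existsP[h /andP[]] : [exists h, (h != k t) && (g t e' h != 0)].
    by exists h.
  apply: contraT => /existsPn z.
  have := dual_bases e' e' (ltnW tm); rewrite eqxx (bigD1 (k t)) //=.
  rewrite (cvanish _ _ _ st ne) mulr0 add0r big1 // => h hk.
  by have := z h; rewrite hk negbK => /eqP->; rewrite mul0r.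
pose pos t := [forall h, 0 <= g t i h + g t j h].
have jm : (tauj < m)%N by apply: leq_trans im; apply: ltnW.
(* Just after its sign change, row [j] vanishes off [k tauj], where row [i] has a positive entry;
   coherence then makes the whole sum nonnegative. *)
have pos_start : pos tauj.+1.
  have [h hk gh] := nonzero _ _ _ jm supp_j ij.
  apply/forallP => l; rewrite leNgt; apply/negP => gl.
  have s := sgn tauj.+1; rewrite ltnSn lt_ji in s.
  apply: (compat _ jm (s isT) h l _ gl).
  have -> : g tauj.+1 j h = 0 by rewrite gS // (negbTE hk) zj.
  rewrite addr0 lt0r; have [-> _] := s isT h.
  by rewrite gS // (negbTE hk) gh.
(* Just before its sign change, row [i] vanishes off [k taui], where row [j] has a negative
   entry. *)
have neg_end : ~~ pos taui.
  have [h hk gh] : exists2 h, h != k taui & g taui j h != 0.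
    by apply: nonzero supp_i _; rewrite // eq_sym.
  apply/forallPn; exists h; rewrite zi // add0r -ltNge lt_neqAle gh.
  by have [] := sgn taui _ h; rewrite // lt_ji leqnn.
(* The sum of the rows changes sign in the step leading to the first such [n], and [sign_change]
   applies to it. *)
have [n /andP[jn neg_n] min_n] :=
  ex_minnP (ex_intro (fun t => (tauj < t)%N && ~~ pos t) taui (introT andP (conj lt_ji neg_end))).
have ni : (n <= taui)%N by apply: min_n; rewrite lt_ji.
case: n => // t in jn neg_n min_n ni *.
have jt : (tauj < t)%N.
  rewrite ltn_neqAle -ltnS jn andbT.
  by apply: contraNneq neg_n => <-.
have tm : (t < m)%N by apply: leq_trans ni (ltnW im).
have pos_t : pos t.
  by apply: contraT => neg; have := min_n t; rewrite jt neg ltnn => /(_ isT).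
have /forallPn[l] := neg_n; rewrite -ltNge => gl.
have [] := @sign_change (fun h => g t i h + g t j h) (fun h => g t.+1 i h + g t.+1 j h)
  (fun e => (i == e)%:R + (j == e)%:R) t.
- move=> e; rewrite -!(dual_bases _ e (ltnW tm)) -big_split.
  by apply: eq_bigr => h _; rewrite mulrDl.
- by move=> h /negbTE hk; rewrite !gS // hk.
- exact/forallP.
- move=> h; rewrite leNgt; apply/negP => gh.
  by apply: compat gh gl => //; apply: sgn; rewrite ni jn.
move=> _ mult; exists t => //.
rewrite (support_of_multiple mult (i := i)); last by rewrite eqxx (eq_sym j) (negbTE ij).
apply/setP=> e; rewrite !inE ![_ == e]eq_sym.
by case: (e == i); case: (e == j).
Qed.

(** The supports of the mutated c-vectors include every singleton and, for each element of [D], a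
    pair of its sides; all these sets are distinct, so there are at least as many steps. *)
Lemma support_count (K : finType) (D : {set K}) (sides : K -> {set V}) :
  (forall x, x \in D -> exists i j l,
     [/\ i \in sides x, j \in sides x & l \in sides x] /\
     [/\ i != j, j != l & l != i] /\
     [/\ compatible i j, compatible j l & compatible l i]) ->
  (forall x y i j, x \in D -> y \in D -> i != j -> i \in sides x -> j \in sides x ->
     i \in sides y -> j \in sides y -> x = y) ->
  (#|V| + #|D| <= m)%N.
Proof.
move=> tris disj.
have [tau tauP] := fin_all_exists simple_step.
pose S := [set support t | t : 'I_m].
have Sin t : (t < m)%N -> support t \in S.
  by move=> tm; apply/imsetP; exists (Ordinal tm).
have pair i j : i != j -> compatible i j -> (tau j < tau i)%N -> [set i; j] \in S.
  case: (tauP i) (tauP j) => ? ? ? ? [? ? ? ?] ij cij lt.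
  have [t tm <-] : exists2 t, (t < m)%N & support t = [set i; j]; last exact: Sin.
  by apply: pair_step ij cij _ _ _ _ _ _ _ lt.
have tau_inj i j : i != j -> tau i != tau j.
  apply: contraNneq => e; have [_ _ si _] := tauP i; have [_ _ sj _] := tauP j.
  by apply/eqP/set1_inj; rewrite -si -sj e.
(* The values of [tau] are distinct, so around the cycle [i], [j], [l] they drop at least once.
   Outside [D] the set is a dummy. *)
have pairs x : exists A, x \in D -> [/\ A \in S, #|A| = 2 & A \subset sides x].
  have [xD|_] := boolP (x \in D); last by exists set0.
  have [i [j [l [[i1 j1 l1] [[ij jl li] [cij cjl cli]]]]]] := tris x xD.
  have [lt|ji] := ltnP (tau j) (tau i).
    exists [set i; j] => _; rewrite pair // cards2 ij; split=> //.
    by rewrite subUset !sub1set i1.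
  have [lt|lj] := ltnP (tau l) (tau j).
    exists [set j; l] => _; rewrite pair // cards2 jl; split=> //.
    by rewrite subUset !sub1set j1.
  exists [set l; i] => _; rewrite pair // ?cards2 ?li.
    by split=> //; rewrite subUset !sub1set l1.
  rewrite ltn_neqAle tau_inj 1?eq_sym //; exact: leq_trans ji lj.
have [P PP] := fin_all_exists pairs.
have P_inj : {in D &, injective P}.
  move=> x y xD yD e; have [_ /eqP/cards2P[i [j [ij Pij]]] sx] := PP x xD.
  have [_ _ sy] := PP y yD; rewrite -e Pij subUset !sub1set in sy.
  rewrite Pij subUset !sub1set in sx; case/andP: sx => ix jx; case/andP: sy => iy jy.
  exact: disj ij ix jx iy jy.
rewrite -(card_in_imset P_inj) -cardsT -(card_imset _ set1_inj).
rewrite -cardsUI.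
have -> : [set [set x] | x in [set: V]] :&: P @: D = set0.
  apply/setP=> A; rewrite !inE; apply/negP => /andP[/imsetP[i _ ->] /imsetP[x xD e]].
  by have [_] := PP x xD; rewrite -e cards1.
rewrite cards0 addn0.
have card_S : (#|S| <= m)%N.
  by rewrite -[X in (_ <= X)%N](card_ord m); apply: leq_imset_card.
apply: leq_trans card_S.
apply/subset_leq_card/subsetP => A; rewrite inE => /orP[/imsetP[i _ ->]|/imsetP[x xD ->]].
  by have [tm _ <- _] := tauP i; apply: Sin.
by have [] := PP x xD.
Qed.

End GreenSteps.

(** * Convex polygons *)

Section Convex.
Import Order.TTheory GRing.Theory Num.Theory.
Local Open Scope ring_scope.

Lemma cyc_side N (i v : 'I_N) : v != i -> v != ordS i -> cyc i (ordS i) v.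
Proof.
rewrite -!val_eqE /= => h1 h2; have := ltn_ord i; have := ltn_ord v.
have [/eqP e | iN] := boolP (i.+1 == N).
  have e0 : (i.+1 %% N)%N = 0%N by rewrite e modnn.
  by move: h1 h2; rewrite e0 /cyc_for /lt_nat; move: e; clear; lia.
have e0 := ltn_ord i; have es : (i.+1 %% N)%N = i.+1.
  by rewrite modn_small // ltn_neqAle iN.
by move: h1 h2; rewrite es /cyc_for /lt_nat; clear; lia.
Qed.

Lemma cyc_cases N (a b x : 'I_N) : a != b -> [\/ x = a, x = b, cyc a b x | cyc a x b].
Proof.
move=> ab; have [->|xa] := eqVneq x a; first by constructor 1.
have [->|xb] := eqVneq x b; first by constructor 2.
move: ab xa xb; rewrite -!val_eqE => ab xa xb.
have : cyc a b x || cyc a x b by move: ab xa xb; rewrite /cyc_for /lt_nat /=; clear; lia.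
by case/orP; [constructor 3 | constructor 4].
Qed.

Variables (R : realFieldType) (N : nat) (p : 'I_N -> 'rV[R]_2).
Hypothesis hp : convex_polygon p.
Implicit Types (a b c x y z i : 'I_N) (d e : {set 'I_N}).

Lemma orient_rot (u v w : 'rV[R]_2) : orient u v w = orient v w u.
Proof. by rewrite /orient; ring. Qed.

Lemma orient_flip (u v w : 'rV[R]_2) : orient u w v = - orient u v w.
Proof. by rewrite /orient; ring. Qed.

(* The affine dependency between four points of the plane. *)
Lemma orient_cramer (a b x y : 'rV[R]_2) (j : 'I_2) :
  orient a b y * x 0 j - orient a b x * y 0 j =
  orient x y a * b 0 j - orient x y b * a 0 j.
Proof.
have [->|->] : j = 0 \/ j = 1.
  by case: j => -[|[|//]] hj; [left|right]; apply: val_inj.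
all: rewrite /orient; move: (a 0 0) (a 0 1) (b 0 0) (b 0 1) => a0 a1 b0 b1;
  move: (x 0 0) (x 0 1) (y 0 0) (y 0 1) => x0 x1 y0 y1; ring.
Qed.

(** Both sides are the cross product of [b - a] and [y - x]. *)
Lemma orient_cross_product (a b x y : 'rV[R]_2) :
  orient a b y - orient a b x = orient x y a - orient x y b.
Proof. by rewrite /orient; ring. Qed.

Lemma orient_segment (u v s t : 'rV[R]_2) r :
  orient u v ((1 - r) *: s + r *: t) = (1 - r) * orient u v s + r * orient u v t.
Proof. by rewrite /orient !mxE; ring. Qed.

Lemma orient_cyc a b c : cyc a b c -> 0 < orient (p a) (p b) (p c).
Proof.
case/or3P => /andP[h1 h2]; first exact: hp.
  by rewrite orient_rot; apply: hp.
by rewrite -orient_rot; apply: hp.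
Qed.

Lemma orient_pos a b c : 0 < orient (p a) (p b) (p c) -> cyc a b c.
Proof.
move=> o; have [ab|ab] := eqVneq a b.
  by move: o; rewrite ab /orient !subrr !mul0r subrr ltxx.
case: (cyc_cases c ab) => [ca|cb|//|ac].
- by move: o; rewrite ca /orient !subrr !mulr0 subrr ltxx.
- by move: o; rewrite cb /orient mulrC subrr ltxx.
- by have := orient_cyc ac; rewrite orient_flip oppr_gt0 => /(lt_trans o); rewrite ltxx.
Qed.

Lemma orient_cyc_neg a b x : cyc a x b -> orient (p a) (p b) (p x) < 0.
Proof. by move=> /orient_cyc; rewrite orient_flip oppr_gt0. Qed.

Lemma vertex_not_interior a : ~ in_interior p (p a).
Proof. by move=> /(_ a); rewrite /orient !subrr !mulr0 subrr ltxx. Qed.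

(** Both ends lie weakly to the left of every side line, and the ends of a diagonal are never both
    on the same one. *)
Lemma segment_interior x y r : x != y -> ~~ is_side [set x; y] -> 0 < r < 1 ->
  in_interior p ((1 - r) *: p x + r *: p y).
Proof.
move=> xy ns /andP[r0 r1] i; rewrite orient_segment.
have nn v : 0 <= orient (p i) (p (ordS i)) (p v).
  have [->|vi] := eqVneq v i; first by rewrite /orient !subrr !mulr0 subrr.
  have [->|vs] := eqVneq v (ordS i); first by rewrite /orient mulrC subrr.
  by apply/ltW/orient_cyc/cyc_side.
have pos v : v != i -> v != ordS i -> 0 < orient (p i) (p (ordS i)) (p v).
  by move=> *; apply/orient_cyc/cyc_side.
have r1' : 0 < 1 - r by rewrite subr_gt0.
have [xb|xg] := boolP ((x == i) || (x == ordS i)); last first.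
  rewrite negb_or in xg; case/andP: xg => x1 x2.
  by apply: ltr_pwDl; [apply: mulr_gt0 => //; apply: pos | apply: mulr_ge0 => //; apply: ltW].
have [yb|yg] := boolP ((y == i) || (y == ordS i)); last first.
  rewrite negb_or in yg; case/andP: yg => y1 y2.
  by apply: ltr_wpDl; [apply: mulr_ge0 => //; apply: ltW | apply: mulr_gt0 => //; apply: pos].
case/negP: ns; apply/existsP; exists i.
case/orP: xb xy => /eqP->; case/orP: yb => /eqP->; rewrite ?eqxx // => _.
by rewrite setUC.
Qed.

Lemma cross_neq a b x y : cross a b x y ->
  [&& a != b, x != y, ~~ is_side [set a; b] & ~~ is_side [set x; y]].
Proof.
move=> h; apply/and4P; split.
- by rewrite -val_eqE; move: h; rewrite /cross_for /cyc_for /lt_nat /=; clear; lia.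
- by rewrite -val_eqE; move: h; rewrite /cross_for /cyc_for /lt_nat /=; clear; lia.
- by apply: contraL h; apply: side_noncrossing.
- by rewrite cross_sym in h; apply: contraL h; apply: side_noncrossing.
Qed.

Lemma cross_intersect a b x y : cross a b x y ->
  intersect_in_interior p [set a; b] [set x; y].
Proof.
have aux a' b' x' y' : cyc a' x' b' -> cyc b' y' a' -> cross a' b' x' y' ->
    intersect_in_interior p [set a'; b'] [set x'; y'].
  move=> h1 h2 /cross_neq/and4P[ab xy nab nxy].
  have al := orient_cyc_neg h1.
  have be : 0 < orient (p a') (p b') (p y') by rewrite orient_rot orient_cyc.
  have h3 : cyc x' b' y' by move: h1 h2; rewrite /cyc_for /lt_nat; clear; lia.
  have h4 : cyc y' a' x' by move: h1 h2; rewrite /cyc_for /lt_nat; clear; lia.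
  have de := orient_cyc_neg h3.
  have ga : 0 < orient (p x') (p y') (p a') by rewrite orient_rot orient_cyc.
  set al' := orient _ _ _ in al; set be' := orient _ _ _ in be.
  set de' := orient _ _ _ in de; set ga' := orient _ _ _ in ga.
  have D0 : be' - al' != 0 by apply: lt0r_neq0; lra.
  have Dpos : 0 < be' - al' by lra.
  have DE : be' - al' = ga' - de' by rewrite /al' /be' /ga' /de' orient_cross_product.
  (* At parameter [r] the signed area against [a'b'] vanishes, at [s] the one against [x'y'];
     Cramer's rule identifies the two points. *)
  pose r := - al' / (be' - al'); pose s := ga' / (be' - al').
  have rE : 0 < r < 1.
    by rewrite /r divr_gt0 ?oppr_gt0 //= ltr_pdivrMr // mul1r; lra.
  have sE : 0 < s < 1.
    by rewrite /s divr_gt0 //= ltr_pdivrMr // mul1r; lra.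
  have zE : (1 - r) *: p x' + r *: p y' = (1 - s) *: p a' + s *: p b'.
    apply/rowP => j; rewrite !mxE /r /s.
    suff : be' * p x' 0 j - al' * p y' 0 j = ga' * p b' 0 j - de' * p a' 0 j.
      move=> E; apply: (mulfI D0).
      have -> : (be' - al') * ((1 - - al' / (be' - al')) * p x' 0 j + - al' / (be' - al') * p y' 0 j)
        = be' * p x' 0 j - al' * p y' 0 j by field.
      rewrite E DE; have D1 : ga' - de' != 0 by rewrite -DE.
      by field.
    exact: orient_cramer.
  exists ((1 - r) *: p x' + r *: p y'); split.
  - exact: segment_interior.
  - by exists a', b', s; rewrite zE; case/andP: sE => /ltW-> /ltW->.
  - by exists x', y', r; case/andP: rE => /ltW-> /ltW->.
move=> h; have /orP[/andP[h1 h2]|/andP[h1 h2]] := h; first exact: aux.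
by rewrite (setUC [set x]); apply: aux => //; rewrite cross_flipr.
Qed.

Lemma orient_ends a b : orient (p a) (p b) (p a) = 0 /\ orient (p a) (p b) (p b) = 0.
Proof. by rewrite /orient; split; ring. Qed.

Lemma on_segment_orient a b (z : 'rV[R]_2) : on_segment p [set a; b] z ->
  orient (p a) (p b) z = 0.
Proof.
have [ea eb] := orient_ends a b.
case=> [x [y [r [/eqP]]]]; rewrite eq_set2 => /orP[] /andP[/eqP/val_inj <- /eqP/val_inj <-] _ ->;
  by rewrite orient_segment ea eb !mulr0 addr0.
Qed.

(** An interior common point is no corner, so it is strictly inside the second segment. The area
    against [ab], a positive combination of its values at the two ends, vanishes there only if the
    ends are strictly on opposite sides or both on [ab]. *)
Lemma noncross_disjoint a b x y : a != b -> x != y -> [set a; b] != [set x; y] ->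
  ~~ cross a b x y -> ~ intersect_in_interior p [set a; b] [set x; y].
Proof.
move=> ab xy ne nc [z [zi /on_segment_orient zab [x1 [y1 [r [/eqP e2 /andP[r0 r1] zr]]]]]].
have xy1 : x1 != y1.
  by apply: contraNneq xy => e; move: e2; rewrite e eq_set2 => /orP[] /andP[/eqP/val_inj-> /eqP/val_inj->].
have {}nc : ~~ cross a b x1 y1.
  move: e2 nc; rewrite eq_set2 => /orP[] /andP[/eqP-> /eqP->] //.
  by rewrite cross_flipr.
rewrite (eqP e2) in ne.
move: zab; rewrite zr orient_segment; have [ea eb] := orient_ends a b.
have r1' : 0 <= 1 - r by rewrite subr_ge0.
have not_end v : z = p v -> False by move=> zv; apply: (@vertex_not_interior v); rewrite -zv.
have r_neq0 : r != 0.
  by apply/eqP => rz; apply: (not_end x1); rewrite zr rz subr0 scale1r scale0r addr0.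
have r_neq1 : 1 - r != 0.
  apply/eqP => rz; apply: (not_end y1); rewrite zr rz scale0r add0r.
  have -> : r = 1 by lra.
  by rewrite scale1r.
have rp : 0 < r by rewrite lt0r r_neq0.
have rp' : 0 < 1 - r by rewrite lt0r r_neq1.
have pos (v : 'I_N) : cyc a b v -> 0 < orient (p a) (p b) (p v) by apply: orient_cyc.
have neg (v : 'I_N) : cyc a v b -> orient (p a) (p b) (p v) < 0 by apply: orient_cyc_neg.
have rotb (v : 'I_N) : cyc a b v = cyc b v a by apply: cyc_rot.
case: (cyc_cases x1 ab) => [ex|ex|cx|cx]; case: (cyc_cases y1 ab) => [ey|ey|cy|cy].
- by rewrite ex ey eqxx in xy1.
- by rewrite ex ey eqxx in ne.
- by rewrite ex ea mulr0 add0r => /eqP; rewrite mulf_eq0 (negbTE r_neq0) gt_eqF ?pos.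
- by rewrite ex ea mulr0 add0r => /eqP; rewrite mulf_eq0 (negbTE r_neq0) lt_eqF ?neg.
- by rewrite ex ey setUC eqxx in ne.
- by rewrite ex ey eqxx in xy1.
- by rewrite ex eb mulr0 add0r => /eqP; rewrite mulf_eq0 (negbTE r_neq0) gt_eqF ?pos.
- by rewrite ex eb mulr0 add0r => /eqP; rewrite mulf_eq0 (negbTE r_neq0) lt_eqF ?neg.
- by rewrite ey ea mulr0 addr0 => /eqP; rewrite mulf_eq0 (negbTE r_neq1) gt_eqF ?pos.
- by rewrite ey eb mulr0 addr0 => /eqP; rewrite mulf_eq0 (negbTE r_neq1) gt_eqF ?pos.
- by move/eqP; rewrite gt_eqF // addr_gt0 // mulr_gt0 // pos.
- by case/negP: nc; rewrite rotb in cx; rewrite /cross_for cy cx orbT.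
- by rewrite ey ea mulr0 addr0 => /eqP; rewrite mulf_eq0 (negbTE r_neq1) lt_eqF ?neg.
- by rewrite ey eb mulr0 addr0 => /eqP; rewrite mulf_eq0 (negbTE r_neq1) lt_eqF ?neg.
- by case/negP: nc; rewrite rotb in cy; rewrite /cross_for cx cy.
- move/eqP; rewrite lt_eqF // -oppr_gt0 opprD -!mulrN.
  by rewrite addr_gt0 // mulr_gt0 // oppr_gt0 neg.
Qed.

Section Triangulation.
Variable T : {set {set 'I_N}}.
Hypothesis hT : triangulation p T.

Lemma triangulation_arc d : d \in T -> is_arc d.
Proof. by case: hT => -[h _] _; apply: h. Qed.

Lemma triangulation_noncrossing a b x y : [set a; b] \in T -> [set x; y] \in T ->
  ~~ cross a b x y.
Proof.
move=> h1 h2; apply/negP => h; case: hT => -[_ nc] _.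
have [e|ne] := eqVneq [set a; b] [set x; y]; last exact: nc h1 h2 ne (cross_intersect h).
move/eqP: e h; rewrite eq_set2 => /orP[] /andP[/eqP-> /eqP->];
  by rewrite /cross_for /cyc_for /lt_nat; clear; lia.
Qed.

Lemma triangulation_maximal a b : a != b -> ~~ is_side [set a; b] ->
  (forall x y, [set x; y] \in T -> ~~ cross a b x y) -> [set a; b] \in T.
Proof.
move=> ab ns nc; case: hT => -[arcs disj] maxT.
have <- : [set a; b] |: T = T; last exact: setU11.
apply: maxT; last exact: subsetUr.
have arc_ab : is_arc [set a; b] by rewrite /is_arc cards2 ab.
have two d : is_arc d -> exists x y, x != y /\ d = [set x; y].
  by case/andP => /cards2P.
have symm d e : intersect_in_interior p d e -> intersect_in_interior p e d.
  by case=> z [z1 z2 z3]; exists z.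
have key e : e \in T -> [set a; b] != e -> ~ intersect_in_interior p [set a; b] e.
  move=> eT; have [x [y [xy eE]]] := two _ (arcs _ eT); rewrite eE in eT *.
  by move=> ne; apply: noncross_disjoint => //; apply: nc.
split.
  by move=> d; rewrite inE => /orP[/set1P->|/arcs].
move=> d e; rewrite !inE => /orP[/eqP->|dT] /orP[/eqP->|eT] ne.
- by rewrite eqxx in ne.
- exact: key.
- by move/symm; apply: key; rewrite // eq_sym.
- exact: disj.
Qed.

End Triangulation.
End Convex.

(** * Triangles and quiver of the given triangulation *)

Lemma card2_sub3 (T : finType) (a b c : T) (e : {set T}) :
  e \subset [set a; b; c] -> #|e| = 2 ->
  [\/ e = [set a; b], e = [set b; c] | e = [set c; a]].
Proof.
move=> sub /eqP/cards2P[u [v [uv eE]]]; move: sub uv.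
rewrite eE subUset !sub1set !inE.
case/andP => /orP[/orP[]|] /eqP-> /orP[/orP[]|] /eqP->; rewrite ?eqxx // => _;
  by [constructor 1 | constructor 2 | constructor 3 |
      rewrite setUC; constructor 1 | rewrite setUC; constructor 2 | rewrite setUC; constructor 3].
Qed.

Section Initial.
Variables (R : realFieldType) (N : nat) (p : 'I_N -> 'rV[R]_2) (T : {set {set 'I_N}}).
Hypotheses (hp : convex_polygon p) (hT : triangulation p T).
Implicit Types (a b c x y z w : 'I_N).

Notation arc := {d : {set 'I_N} | d \in T}.
Let f0 : arc -> {set 'I_N} := val.

Lemma edge_initial x y : edge f0 x y = is_side [set x; y] || ([set x; y] \in T).
Proof.
congr (_ || _); apply/existsP/idP => [[h /eqP <-]|h]; first exact: valP.
by exists (exist (fun d => d \in T) _ h).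
Qed.

Lemma initial_inj : injective f0. Proof. exact: val_inj. Qed.

Lemma initial_noncrossing : noncrossing f0.
Proof.
move=> h l x y z w hx hz; apply: (triangulation_noncrossing hp hT).
  by rewrite -hx; apply: valP.
by rewrite -hz; apply: valP.
Qed.

Lemma arc_ends a c : [set a; c] \in T -> a != c /\ ~~ is_side [set a; c].
Proof. by move/(triangulation_arc hT)/andP; rewrite cards2; case: (a != c) => -[]. Qed.

(** Take for [b] the last vertex between [a] and [c] that is joined to [a]. An arc across [bc] would
    start at [a] and end beyond [b]; so there is none, and maximality makes [bc] an edge. *)
Lemma initial_apex a c : [set a; c] \in T -> exists b, tri f0 a b c.
Proof.
move=> acT; have [ac nside] := arc_ends acT.
have side_s : edge f0 a (ordS a).
  by apply/orP; left; apply/existsP; exists a.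
have c_s : c != ordS a.
  by apply: contraNneq nside => ->; apply/existsP; exists a.
(* The number of counterclockwise steps from [a] to [x], with a wrap at [N]. *)
pose pos x := if a <= x then x - a else x + N - a.
pose P b := cyc a b c && edge f0 a b.
have Ps : P (ordS a) by rewrite /P side_s cyc_side // eq_sym.
case: (arg_maxnP pos Ps) => b /andP[abc eab] bmax.
exists b; rewrite /tri abc eab (edgeC _ c a) !edge_initial acT orbT andbT /=.
have [//|ns] := boolP (is_side [set b; c]).
apply: (triangulation_maximal hp hT) => //.
  by have := cyc_uniq abc; rewrite -val_eqE => /and3P[].
move=> x y xyT; apply/negP => cr.
have exy : edge f0 x y by rewrite edge_initial xyT orbT.
have eac : edge f0 a c by rewrite edge_initial acT orbT.
have nac := edge_noncrossing initial_noncrossing eac exy.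
have nab := edge_noncrossing initial_noncrossing eab exy.
have contra x' : edge f0 a x' -> cyc b x' c -> False.
  move=> e bxc; have : P x'.
    by rewrite /P e andbT; move: abc bxc; rewrite /cyc_for /lt_nat; clear; lia.
  move/bmax; rewrite /pos /=; have := ltn_ord b; have := ltn_ord a.
  move: abc bxc; rewrite /cyc_for /lt_nat; clear.
  move: (nat_of_ord a) (nat_of_ord b) (nat_of_ord c) (nat_of_ord x') => a' b' c' y'.
  by case: (leqP a' y'); case: (leqP a' b'); lia.
case/orP: (cross_fan abc cr nac nab) => /andP[/eq_forP/val_inj e h].
  by apply: contra h; rewrite -e edgeC.
by apply: contra h; rewrite -e.
Qed.

Lemma initial_quad h : exists a b c d, quad f0 h a b c d.
Proof.
have /andP[/cards2P[a [c [ac hE]]] _] := triangulation_arc hT (valP h).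
have acT : [set a; c] \in T by rewrite -hE; apply: valP.
have [b tb] := initial_apex acT; have [|d td] := @initial_apex c a; first by rewrite setUC.
by exists a, b, c, d; rewrite /quad /f0 hE eqxx tb.
Qed.

Lemma is_triangle_tri a b c : tri f0 a b c -> is_triangle T [set a; b; c].
Proof.
case/and4P => cabc e1 e2 e3; apply/andP; split.
  have := cyc_uniq cabc; rewrite !val_eqE => /and3P[n1 n2 n3].
  by rewrite setUC cardsU1 !inE (negbTE n3) (eq_sym c b) (negbTE n2) cards2 n1.
apply/forallP => e; apply/implyP => /andP[sub /eqP card].
by case: (card2_sub3 sub card) => ->; rewrite -edge_initial.
Qed.

Lemma tri_is_triangle a b c : is_triangle T [set a; b; c] -> cyc a b c -> tri f0 a b c.
Proof.
move=> /andP[_ /forallP edges] cabc.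
have := cyc_uniq cabc; rewrite !val_eqE => /and3P[n1 n2 n3].
have side x y : x != y -> [set x; y] \subset [set a; b; c] -> edge f0 x y.
  by move=> xy sub; have := edges [set x; y]; rewrite sub cards2 xy edge_initial.
by rewrite /tri cabc !side //=; apply/subsetP => x; rewrite !inE => /orP[]->; rewrite ?orbT.
Qed.

Lemma follows_tri D (i j : {set 'I_N}) :
  reflect (exists a b c, [/\ tri f0 a b c, D = [set a; b; c], i = [set a; b] & j = [set b; c]])
    (is_triangle T D && follows p D i j).
Proof.
apply: (iffP andP) => [[tD /existsP[a /existsP[b /existsP[c]]]]|[a [b [c [t -> -> ->]]]]].
  case/and4P => /eqP DE /(orient_pos hp) cabc /eqP iE /eqP jE.
  by exists a, b, c; split=> //; apply: tri_is_triangle; rewrite // -DE.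
split; first exact: is_triangle_tri.
apply/existsP; exists a; apply/existsP; exists b; apply/existsP; exists c.
by rewrite !eqxx (orient_cyc hp) //; case/and4P: t.
Qed.

Lemma initial_exchange : exchange_inv f0 (framed (quiver_of_triangulation p T)).
Proof.
have nf := initial_noncrossing.
(* The arc [l] cannot be both relevant sides at once, so the number of triangles is the sum of two
   indicators. *)
have card_or (K : finType) (A B : K) (b1 b2 : bool) : ~~ (b1 && b2) ->
    #|[set D | (D == A) && b1 || (D == B) && b2]| = b1 + b2.
  case: b1; case: b2 => //= _.
  - by rewrite addn0 -(cards1 A); apply: eq_card => D; rewrite !inE andbT andbF orbF.
  - by rewrite add0n -(cards1 B); apply: eq_card => D; rewrite !inE andbT andbF.
  - by apply/eqP; rewrite cards_eq0; apply/eqP/setP => D; rewrite !inE !andbF.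
move=> h x y z w q l; have pts := quad_points q.
have /and3P[/eqP hE t1 t2] := q.
rewrite /= /quiver_of_triangulation; split.
  rewrite -(card_or _ [set z; x; y] [set x; z; w]); last first.
    apply/negP => /andP[/eqP-> ]; rewrite eq_set2.
    by move: pts; clear; lia.
  apply: eq_card => D; rewrite !inE; apply/(@follows_tri D (f0 h) (f0 l))/idP.
    move=> [a [b [c [t -> hab ->]]]].
    move: hab => /eqP; rewrite hE eq_set2 => /orP[] /andP[/eqP/val_inj ex /eqP/val_inj ez]; subst a b.
      by rewrite (tri_apex nf t (tri_rot (tri_rot t2))) !eqxx orbT.
    by rewrite (tri_apex nf t (tri_rot (tri_rot t1))) !eqxx.
  case/orP => /andP[/eqP-> /eqP lE].
    by exists z, x, y; split; rewrite ?hE ?lE // 1?setUC //; apply/tri_rot/tri_rot.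
  by exists x, z, w; split; rewrite ?hE ?lE //; apply/tri_rot/tri_rot.
rewrite -(card_or _ [set y; z; x] [set w; x; z]); last first.
  apply/negP => /andP[/eqP-> ]; rewrite eq_set2.
  by move: pts; clear; lia.
apply: eq_card => D; rewrite !inE; apply/(@follows_tri D (f0 l) (f0 h))/idP.
  move=> [a [b [c [t -> -> hab]]]].
  move: hab => /eqP; rewrite hE eq_set2 => /orP[] /andP[/eqP/val_inj ex /eqP/val_inj ez]; subst b c.
    by rewrite (tri_apex nf (tri_rot t) (tri_rot (tri_rot t2))) !eqxx orbT.
  by rewrite (tri_apex nf (tri_rot t) (tri_rot (tri_rot t1))) !eqxx.
case/orP => /andP[/eqP-> /eqP lE].
  by exists y, z, x; split; rewrite ?hE ?lE // 1?setUC //; apply/tri_rot.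
by exists w, x, z; split; rewrite ?hE ?lE //; apply/tri_rot.
Qed.

End Initial.

(** * The sequence of flips *)

Section RunQuiver.
Variable V : finType.
Implicit Types (Q : quiver (V + V)%type) (k : nat -> V).

Fixpoint run_mutations Q k t :=
  if t is t'.+1 then mutation (inl (k t')) (run_mutations Q k t') else Q.

Lemma run_mutations_shift Q k t :
  run_mutations Q k t.+1 = run_mutations (mutation (inl (k 0%N)) Q) (k \o succn) t.
Proof. by elim: t => //= t <-. Qed.

Lemma green_to_red_run Q s x0 : green_to_red Q s ->
  (forall t, t < size s -> green (run_mutations Q (nth x0 s) t) (nth x0 s t)) /\
  forall h, red (run_mutations Q (nth x0 s) (size s)) h.
Proof.
elim: s Q => [|h s IH] Q /=; first by move/forallP.
case/andP=> gh /IH[greens reds].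
have shift t : run_mutations Q (nth x0 (h :: s)) t.+1 =
    run_mutations (mutation (inl h) Q) (nth x0 s) t.
  by rewrite run_mutations_shift.
split; last by move=> h'; have := reds h'; rewrite -shift.
by case=> [|t] ht //; rewrite shift; apply: greens.
Qed.

End RunQuiver.

Section RunFlips.
Import Order.TTheory GRing.Theory Num.Theory.
Variables (N : nat) (V : finType) (f0 : V -> {set 'I_N}) (Q0 : quiver V).
Hypotheses (f0_inj : injective f0) (f0_nc : noncrossing f0).
Variables (p q r s : V -> 'I_N).
Hypotheses (f0_quad : forall i, quad f0 i (p i) (q i) (r i) (s i))
  (Q0_exchange : exchange_inv f0 (framed Q0)).
Variables (m : nat) (k : nat -> V).
Let Q := run_mutations (framed Q0) k.
Hypotheses (Q_green : forall t, t < m -> green (Q t) (k t))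
  (Q_red : forall h, red (Q m) h).

Local Notation sepT := (separates p r).
Local Notation shearT := (shear p q r s).

(** For a noncrossing [f] the two possible labellings of the quadrilateral give the same new arc; if
    there is no quadrilateral, [f] is left unchanged. *)
Definition flip_at (f : V -> {set 'I_N}) (l : V) :=
  if [pick u : 'I_N * 'I_N * 'I_N * 'I_N | quad f l u.1.1.1 u.1.1.2 u.1.2 u.2] is Some u
  then flip f l [set u.1.1.2; u.2] else f.

Fixpoint flips t := if t is t'.+1 then flip_at (flips t') (k t') else f0.

Lemma flip_atP f l : (exists a b c d, quad f l a b c d) ->
  exists a b c d, quad f l a b c d /\ flip_at f l = flip f l [set b; d].
Proof.
move=> [a [b [c [d abcd]]]]; rewrite /flip_at; case: pickP => [[[[x y] z] w] /= xyzw|].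
  by exists x, y, z, w.
by move=> /(_ (a, b, c, d)); rewrite /= abcd.
Qed.

Definition run_inv t := [/\ injective (flips t), noncrossing (flips t),
  forall h, exists a b c d, quad (flips t) h a b c d,
  exchange_inv (flips t) (Q t) & frozen_inv (flips t) (Q t) sepT].

Lemma run_mutationsS t : Q t.+1 = mutation (inl (k t)) (Q t). Proof. by []. Qed.

Lemma no_arrow_into_green t e : t < m -> Q t (inr e) (inl (k t)) = 0.
Proof. by move=> tm; have /forallP/(_ e)/eqP := Q_green tm. Qed.

Lemma ends_neq e : p e != r e :> nat.
Proof. by have [/cyc_uniq/and3P[_ _]] := quad_cycs (f0_quad e); rewrite eq_sym. Qed.

Lemma run_inv0 : run_inv 0.
Proof.
split=> //; first by move=> h; exists (p h), (q h), (r h), (s h).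
move=> h x y z w hq e; have [h1 h2] := quad_cycs hq; have [e1 e2 e3 e4] := quad_edges hq.
have ee := edge_of_f (quad_diag (f0_quad e)).
have nc u v : edge f0 u v -> ~~ cross u v (p e) (r e) by move=> e'; apply: edge_noncrossing e' ee.
have := sep_initial h1 h2 (ends_neq e) (nc _ _ e1) (nc _ _ e2) (nc _ _ e3) (nc _ _ e4)
  (nc _ _ (edge_of_f (quad_diag hq))).
rewrite !eq_forE -eq_set2 -(quad_diag (f0_quad e)) -(quad_diag hq) (inj_eq f0_inj).
by rewrite /separates /= => ->; rewrite -addnA addnC.
Qed.

Lemma run_step t : t < m -> run_inv t -> exists a b c d,
  [/\ quad (flips t) (k t) a b c d, flips t.+1 = flip (flips t) (k t) [set b; d],
    forall e, sepT e a c + sepT e b d = sepT e b c + sepT e d a &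
    run_inv t.+1].
Proof.
move=> tm [inj nc quads exch froz].
have [a [b [c [d [kq flipE]]]]] := flip_atP (quads (k t)).
have gr e := no_arrow_into_green e tm.
have X e : sepT e a c + sepT e b d = sepT e b c + sepT e d a.
  have [h1 h2] := quad_cycs kq.
  apply: (tropical_exchange h1 h2 (ends_neq e)); have := froz _ _ _ _ _ kq e.
  by rewrite gr double0 add0n /separates -addnA => <-; apply: leq_addl.
exists a, b, c, d; split=> //.
rewrite /run_inv [flips t.+1]flipE run_mutationsS; split.
- exact: flip_inj inj nc kq.
- exact: flip_noncrossing inj nc kq.
- exact: flip_quads inj nc kq quads.
- exact (flip_exchange_inv inj nc kq exch).
- exact (flip_frozen_inv inj nc kq exch froz (@separatesC _ _ p r) gr X).
Qed.

Lemma run_invP t : t <= m -> run_inv t.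
Proof.
elim: t => [_|t IH tm]; first exact: run_inv0.
by have [a [b [c [d []]]]] := run_step tm (IH (ltnW tm)).
Qed.

Definition c_vector t h e : int := (Posz (Q t (inl h) (inr e)) - Posz (Q t (inr e) (inl h)))%R.
Definition g_vector t i h : int := shearT i (flips t h).
Definition weight t h : int := Posz (Q t (inl h) (inl (k t))).

(** A side of the polygon carries no label, but its shear coordinates are 0, so sides need no
    separate term. *)
Lemma sum_at_edge (f : V -> {set 'I_N}) i (x y : 'I_N) :
  injective f -> edge f x y -> x != y :> nat ->
  (\sum_l Posz (at_edge f l x y) * shearT i (f l))%R = shearT i [set x; y].
Proof.
move=> inj exy xy; have [[h /eqP hE]|no] := altP (@existsP _ (fun h => f h == [set x; y])).
  rewrite (bigD1 h) //= /at_edge hE eqxx mul1r big1 ?addr0 // => l lh.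
  by rewrite -hE (inj_eq inj) (negbTE lh) mul0r.
have side : is_side [set x; y] by move: exy; rewrite /edge (negbTE no) orbF.
rewrite (shear_side f0_quad i side xy) big1 // => l _.
by move/existsPn: no => /(_ l) /negbTE; rewrite /at_edge => ->; rewrite mul0r.
Qed.

Lemma exchange_loop t : t <= m -> Q t (inl (k t)) (inl (k t)) = 0.
Proof.
case/run_invP=> _ _ quads exch _; have [a [b [c [d kq]]]] := quads (k t).
exact: exchange_inv_loop kq exch.
Qed.

(** Truncation disappears in the difference of the two arrow counts, and greenness excludes paths
    from a frozen vertex through [k t]. *)
Lemma c_vectorS t h e : t < m -> c_vector t.+1 h e =
  if h == k t then (- c_vector t h e)%R
  else (c_vector t h e + weight t h * c_vector t (k t) e)%R.
Proof.
move=> tm; have loop := exchange_loop (ltnW tm); have gr := no_arrow_into_green e tm.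
rewrite /c_vector run_mutationsS /weight gr.
have [->|hk] := eqVneq h (k t).
  by have [-> ->] := mutation_at (inr e) loop; rewrite gr; clear; lia.
rewrite /mutation /cancel_2cycles /reverse_at /add_paths !inl_eq (negbTE hk) /= gr mul0n addn0.
by rewrite subr0 -PoszM; clear; lia.
Qed.

(** This is [shear_exchange] for the flip, since the arrows into [k t] come from the sides [bc] and
    [da]. *)
Lemma g_vectorS t i h : t < m -> g_vector t.+1 i h =
  if h == k t then (- g_vector t i h + \sum_l weight t l * g_vector t i l)%R
  else g_vector t i h.
Proof.
move=> tm; have inv := run_invP (ltnW tm); have [inj nc _ exch _] := inv.
have [a [b [c [d [kq flipE X _]]]]] := run_step tm inv.
rewrite /g_vector flipE; have [->|hk] := eqVneq h (k t); last by rewrite flip_neq_k.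
have := shear_exchange f0_quad i kq X.
have [_ ebc _ eda] := quad_edges kq; have /and5P[_ nbc _ _ /andP[nda _]] := quad_points kq.
rewrite -(sum_at_edge i inj ebc nbc) -(sum_at_edge i inj eda nda) -big_split /=.
have -> : flip (flips t) (k t) [set b; d] (k t) = [set b; d] by rewrite /flip eqxx.
rewrite (quad_diag kq) => /(canRL (addKr _)) ->.
congr (_ + _)%R; apply: eq_bigr => l _; rewrite -mulrDl; congr (_ * _)%R.
by rewrite /weight; have [_ ->] := exch _ _ _ _ _ kq l; rewrite PoszD.
Qed.

Lemma compatible_tri i j A B C : tri f0 A B C -> f0 i = [set A; B] -> f0 j = [set B; C] ->
  compatible m g_vector i j.
Proof.
move=> t fi fj n nm sgn h l; have [_ nc _ _ _] := run_invP nm.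
exact: (shear_pentagon f0_nc f0_quad nc t fi fj sgn).
Qed.

Lemma length_bound (K : finType) (D : {set K}) (sides : K -> {set V}) :
  (forall x, x \in D -> exists A B C i j l, tri f0 A B C /\
     [/\ f0 i = [set A; B], f0 j = [set B; C] & f0 l = [set C; A]] /\
     [/\ i \in sides x, j \in sides x & l \in sides x]) ->
  (forall x y i j, x \in D -> y \in D -> i != j -> i \in sides x -> j \in sides x ->
     i \in sides y -> j \in sides y -> x = y) ->
  #|V| + #|D| <= m.
Proof.
move=> tris; apply: (@support_count V m k c_vector g_vector weight).
- by move=> h e; rewrite /c_vector /= subr0 natz.
- exact: c_vectorS.
- by move=> t e tm; rewrite /c_vector no_arrow_into_green // subr0.
- by move=> h e; rewrite /c_vector; have /forallP/(_ e)/eqP-> := Q_red h; rewrite sub0r oppr_le0.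
- by move=> i h; rewrite /g_vector shear_initial // natz.
- exact: g_vectorS.
- by move=> t tm; rewrite /weight exchange_loop // ltnW.
- by move=> t i h l /run_invP[_ nc _ _ _] g1 g2; apply: (shear_coherent f0_nc f0_quad nc g1 g2).
move=> x xD; have [A [B [C [i [j [l [t [[iE jE lE] [ix jx lx]]]]]]]]] := tris x xD.
exists i, j, l; split=> //; split; last first.
  by split; [apply: compatible_tri t iE jE | apply: compatible_tri (tri_rot t) jE lE
    | apply: compatible_tri (tri_rot (tri_rot t)) lE iE].
have /cyc_uniq/and3P[n1 n2 n3] : cyc A B C by case/and4P: t.
have neq u v (X Y : {set 'I_N}) : f0 u = X -> f0 v = Y -> X != Y -> u != v.
  by move=> <- <-; apply: contraNneq => ->.
split; [apply: neq iE jE _ | apply: neq jE lE _ | apply: neq lE iE _]; rewrite eq_set2;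
  by move: n1 n2 n3; clear; lia.
Qed.

End RunFlips.

(** * Interior triangles and the final count *)

Lemma interior_triangle_corners N (T : {set {set 'I_N}}) (D : {set 'I_N}) :
  is_interior_triangle T D -> exists a b c : 'I_N,
  [/\ D = [set a; b; c], cyc a b c &
    [/\ [set a; b] \in T, [set b; c] \in T & [set c; a] \in T]].
Proof.
case/andP=> /eqP card3 /forallP edges.
have [a aD] : exists a, a \in D by apply/card_gt0P; rewrite card3.
have : #|D :\ a| == 2 by have := cardsD1 a D; rewrite aD card3 => /eqP; rewrite add1n eqSS eq_sym.
case/cards2P => b [c [bc DE]].
have {}DE : D = [set a; b; c].
  by rewrite -(setD1K aD) DE setUA.
have ab : a != b by apply/eqP => e; move: card3; rewrite DE e setUid cards2 bc.
have ca : c != a by apply/eqP => e; move: card3; rewrite DE e setUAC setUid cards2 ab.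
have side x y : x != y -> x \in D -> y \in D -> [set x; y] \in T.
  by move=> xy xD yD; have := edges [set x; y]; rewrite cards2 xy subUset !sub1set xD yD.
have [h1 h2 h3] : [/\ a \in D, b \in D & c \in D] by rewrite DE !inE !eqxx ?orbT.
have : cyc a b c || cyc a c b.
  by move: ab bc ca; rewrite -!val_eqE /cyc_for /lt_nat /=; clear; lia.
case/orP => h; first by exists a, b, c; rewrite !side.
by exists a, c, b; rewrite !side // 1?eq_sym //; split; rewrite // DE setUAC.
Qed.

Theorem theorem7p2 (R : realFieldType) (N : nat) (p : 'I_N -> 'rV[R]_2)
    (T : {set {set 'I_N}}) (s : seq {d : {set 'I_N} | d \in T})
    (hN : (3 <= N)%N) (hp : convex_polygon p) (hT : triangulation p T)
    (hs : maximal_green_sequence (quiver_of_triangulation p T) s) :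
  (#|T| + num_interior_triangles T <= size s)%N.
Proof.
pose arc := {d : {set 'I_N} | d \in T}.
(* An arc is needed as default value for [nth]; without arcs both counts are 0. *)
have [x0 _ | no_arc] := pickP (@predT arc); last first.
  have noT d : d \in T = false by apply/negP => dT; have := no_arc (exist _ d dT).
  have -> : #|T| = 0 by apply: eq_card0.
  rewrite /num_interior_triangles eq_card0 // => D; rewrite inE.
  by apply/negP => /interior_triangle_corners[a [b [c [_ _ []]]]]; rewrite noT.
have [u uP] := fin_all_exists (initial_quad hp hT).
have [v vP] := fin_all_exists uP.
have [w wP] := fin_all_exists vP.
have [z zP] := fin_all_exists wP.
have [greens reds] := green_to_red_run x0 hs.
have -> : #|T| = #|{: arc}| by rewrite card_sig; apply: eq_card => d; rewrite inE.
apply: (length_bound (@initial_inj _ T) (initial_noncrossing hp hT) zP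
  (initial_exchange hp hT) greens reds
  (D := [set D | is_interior_triangle T D])
  (sides := fun D => [set a : arc | val a \subset D])).
  move=> D; rewrite inE => /interior_triangle_corners[a [b [c [DE cabc [h1 h2 h3]]]]].
  pose ex := exist (fun d : {set 'I_N} => d \in T).
  exists a, b, c, (ex _ h1), (ex _ h2), (ex _ h3); split; [|split].
  - by rewrite /tri cabc !edge_initial h1 h2 h3 !orbT.
  - by [].
  - by rewrite !inE DE !subUset !sub1set !inE !eqxx ?orbT.
(* Two distinct arcs have at least three endpoints, so together they determine the triangle that
   contains them. *)
have join D i j : D \in [set D | is_interior_triangle T D] -> i != j :> arc ->
    val i \subset D -> val j \subset D -> D = val i :|: val j.
  rewrite inE => /andP[/eqP card3 _] ij iD jD; apply/eqP; rewrite eq_sym eqEcard.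
  rewrite subUset iD jD card3 ltnNge; apply: contra ij => le2.
  have card2 (d : arc) : #|val d| = 2.
    by have /andP[/eqP] := triangulation_arc hT (valP d).
  rewrite -val_eqE; have /eqP-> : val i == val i :|: val j.
    by rewrite eqEcard subsetUl card2.
  by rewrite eq_sym eqEcard subsetUr card2.
move=> D E i j DI EI ij; rewrite !inE => i1 j1 i2 j2.
by rewrite (join D i j DI ij i1 j1) -(join E i j EI ij i2 j2).
Qed.
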